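(* Let $K$ be a number field of degree $n$ over $\mathbb{Q}$ with ring of integers $\mathcal{O}$, let $F(w)\in\mathbb{Z}[u_1,\dots,u_n][w]$ be the left-hand side of its fundamental equation (with respect to an integral basis), and let $p$ be a rational prime. Let $$F(w)\equiv \mathfrak{F}_1(w)^{\delta_1}\cdots\mathfrak{F}_h(w)^{\delta_h}\pmod p$$ be the decomposition of $F$ modulo $p$ into powers of distinct irreducible factors (monic in $w$) in $\mathbb{F}_p[u_1,\dots,u_n][w]$. Suppose that exactly $\lambda_1,\dots,\lambda_\gamma$ of the factors $\mathfrak{F}_1,\dots,\mathfrak{F}_h$ have degree $\kappa_1,\dots,\kappa_\gamma$ respectively as polynomials in $w$, where the $\kappa_i$ are pairwise distinct and $\lambda_1+\cdots+\lambda_\gamma=h$. Then $p$ is a common inessential divisor of all equation discriminants $\mathfrak{D}(\xi_0)$, $\xi_0\in\mathcal{O}$, if and only if at least one of the $\gamma$ conditions $$\lambda_1>\bar g(\kappa_1),\ \dots,\ \lambda_\gamma>\bar g(\kappa_\gamma)$$ is satisfied.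
   Context: Let $\xi_1,\dots,\xi_n$ be an integral basis of $\mathcal{O}$ and $u_1,\dots,u_n$ indeterminates. The fundamental form is $w_0=u_1\xi_1+\cdots+u_n\xi_n$; its conjugates $w_0,w_1,\dots,w_{n-1}$ are obtained by replacing the $\xi_i$ by their conjugates under the $n$ embeddings of $K$. The fundamental equation is $F(w)=\prod_{j=0}^{n-1}(w-w_j)=0$, with $F\in\mathbb{Z}[u_1,\dots,u_n][w]$. For $\xi_0\in\mathcal{O}$, write $\xi_0^k=a_{1k}\xi_1+\cdots+a_{nk}\xi_n$ ($k=0,\dots,n-1$) with $a_{ik}\in\mathbb{Z}$. The equation discriminant $\mathfrak{D}(\xi_0)$ is the discriminant of the degree $n$ (characteristic) equation of $\xi_0$, and $\mathfrak{D}(\xi_0)=|a_{ik}|^2 D$, where $|a_{ik}|$ is the determinant and $D$ is the discriminant of $K$. A prime $p$ is an inessential divisor of $\mathfrak{D}(\xi_0)$ if it divides the determinant $|a_{ik}|$, and a common inessential divisor of all equation discriminants if this holds for every $\xi_0\in\mathcal{O}$. For a positive integer $\kappa$, $$\bar g(\kappa)=\frac1\kappa\Big(p^\kappa-\sum p^{\kappa/q}+\sum p^{\kappa/(qq')}-\cdots\Big),$$ where $q,q',\dots$ are the distinct prime factors of $\kappa$; equivalently $\bar g(\kappa)=\frac1\kappa\sum_{d\mid\kappa}\mu(\kappa/d)p^d$ with $\mu$ the Möbius function. *)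

(* Defs.v *)
From HB Require Import structures.
From mathcomp Require Import all_boot all_order all_algebra all_field.
From mathcomp Require Export mpoly.

Set Implicit Arguments.
Unset Strict Implicit.
Unset Printing Implicit Defensive.

Import Order.TTheory GRing.Theory Num.Theory.
Local Open Scope ring_scope.

Section NumberField.
Variables (K : fieldExtType rat) (n : nat).

(* The ring of integers of K, as a predicate on K. *)
Definition algebraic_integer (x : K) : Prop :=
  integralOver (intr : int -> K) x.

(* A basis of the ring of integers as a Z-module; Z-linear independence is the
   uniqueness of coordinates (for x = 0). *)
Definition integral_basis (xi : 'I_n -> K) : Prop :=
  (forall i, algebraic_integer (xi i)) /\
  (forall x, algebraic_integer x ->
     exists! a : {ffun 'I_n -> int}, x = \sum_(i < n) xi i *~ a i).

(* sigma lists every embedding of K into the algebraic numbers exactly once.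
   Working in algC rather than in the complex numbers loses nothing, since the
   image of any complex embedding of K is algebraic. *)
Definition embeddings (sigma : 'I_n -> {rmorphism K -> algC}) : Prop :=
  forall tau : {rmorphism K -> algC}, exists! j, sigma j =1 tau.

Definition conj_fundamental_form (xi : 'I_n -> K) (s : K -> algC) :
    {mpoly algC[n]} :=
  \sum_(i < n) s (xi i) *: 'X_i.

(* F is the left-hand side of the fundamental equation. It has coefficients in
   Z[u_1, ..., u_n] and its defining product has coefficients in algC[u]; as the
   extension of scalars from int to algC is injective, F is unique. *)
Definition fundamental_polynomial (xi : 'I_n -> K)
    (sigma : 'I_n -> {rmorphism K -> algC}) (F : {poly {mpoly int[n]}}) : Prop :=
  map_poly (map_mpoly (intr : int -> algC)) F
  = \prod_(j < n) ('X - (conj_fundamental_form xi (sigma j))%:P).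

(* A is the matrix (a_ik) of coordinates of the powers x^0, ..., x^(n-1). *)
Definition power_coordinates (xi : 'I_n -> K) (x : K) (A : 'M[int]_n) : Prop :=
  forall k : 'I_n, x ^+ k = \sum_(i < n) xi i *~ A i k.

(* The discriminant of the characteristic equation of x is (\det A)^2 times the
   discriminant of K; p is an inessential divisor of it when p divides \det A.
   When xi is an integral basis and x is an algebraic integer, A exists and is
   unique. *)
Definition inessential_divisor (xi : 'I_n -> K) (p : nat) (x : K) : Prop :=
  exists2 A : 'M[int]_n, power_coordinates xi x A & (p%:Z %| \det A)%Z.

Definition common_inessential_divisor (xi : 'I_n -> K) (p : nat) : Prop :=
  forall x : K, algebraic_integer x -> inessential_divisor xi p x.

End NumberField.

(* irreducible_poly is about divisibility up to scalars, hence only appropriate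
   over a field; here the coefficients are themselves polynomials. *)
Definition irreducible_element (R : idomainType) (x : R) : Prop :=
  [/\ x != 0, x \isn't a GRing.unit &
      forall a b : R, x = a * b -> (a \is a GRing.unit) \/ (b \is a GRing.unit)].

Definition reduction (n p : nat) (F : {poly {mpoly int[n]}}) :
    {poly {mpoly 'F_p[n]}} :=
  map_poly (map_mpoly (intr : int -> 'F_p)) F.

(* (1/k) (p^k - \sum p^(k/q) + \sum p^(k/(q q')) - ...), as a sum over the sets S
   of prime divisors of k, realized inside 'I_k.+1. *)
Definition gbar (p k : nat) : rat :=
  (k%:R)^-1 *
  \sum_(S : {set 'I_k.+1} | S \subset [set q : 'I_k.+1 | val q \in primes k])
     (-1) ^+ #|S| * (p ^ (k %/ \prod_(q in S) val q))%N%:R.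

(* Main.v *)
Require Import Defs.
From HB Require Import structures.
From mathcomp Require Import all_boot all_order all_algebra all_field.

Set Implicit Arguments.
Unset Strict Implicit.
Unset Printing Implicit Defensive.

Import Order.TTheory GRing.Theory Num.Theory.
Local Open Scope ring_scope.

(** Let O be the ring of integers of K, let R = O/pO, and let L be an algebraic
    closure of F_p.  Modulo p the matrix (a_ik) of an integer x holds the
    coordinates in R of 1, x, ..., x^(n-1), so p is not a common inessential
    divisor exactly when R = F_p[x] for some x.  Both sides of the theorem are
    read off from the characters of R, the ring morphisms chi : R -> L, on which
    the Frobenius of L acts.

    F is the characteristic polynomial of multiplication by the generic integer
    u_1 xi_1 + ... + u_n xi_n ([fundamental_char_poly]), so F mod p is the
    characteristic polynomial of the generic element of R.  The commuting
    multiplication matrices of R become triangular together over L, and the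
    entries on the diagonal are characters; hence F mod p is a product of linear
    factors w - (u_1 chi(xi_1) + ... + u_n chi(xi_n)), and every character occurs
    ([generic_char_poly_split], [root_generic_char_poly]).  By Galois descent an
    irreducible factor over F_p is the product over one Frobenius orbit of
    characters, and its degree is the size of that orbit
    ([irreducible_factors_orbits]).  So kappa * lambda counts the characters
    whose orbit has kappa elements, while kappa * gbar kappa counts the elements
    of L of degree kappa over F_p, by inclusion-exclusion
    ([size_exact_period_points]).

    If the powers of x span R, then chi |-> chi(x) is injective and commutes with
    Frobenius, so it preserves degrees and lambda <= gbar kappa for each kappa.
    Conversely, these inequalities provide an injection c of the characters into
    L that commutes with Frobenius ([equivariant_injection]), and by descent some
    y in R satisfies chi(y) = c(chi) for all chi ([equivariant_values]).  Distinct
    values at the characters are not enough for x to generate R: over L, a proper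
    subalgebra of the form L[x] is detected either by two characters that agree
    at x or by a nonzero derivation at a character that kills x
    ([power_matrix_nondegenerate]).

    Maximality of O enters at this point.  If the kernel P of a character were
    mapped into itself by a / p, where a is a nonzero element of R killed by P,
    then a / p would be integral, which is absurd; so multiplication by a / p
    sends some pi of P outside P, and pi generates P locally
    ([residue_principal_kernel]).  A derivation at this character that kills pi
    is therefore zero.  As derivations kill p-th powers, a combination w of such
    elements pi, with p-th powers as coefficients, vanishes at all characters and
    is killed by no nonzero derivation; then x = y^p + w generates R
    ([monogenic_of_equivariant_injection]). *)

(** * Independence of characters and common eigenvectors *)

(** In a relation of minimal length, subtracting [chi t0 a] times the relation
    from its translate by [a] shortens it without killing the term [s], unless
    [chi s a = chi t0 a]. *)
Lemma dedekind_independence (A : nzRingType) (F : idomainType) (T : finType)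
    (chi : T -> {rmorphism A -> F}) (y : T -> F) :
  (forall s t, chi s =1 chi t -> s = t) ->
  (forall r, \sum_t y t * chi t r = 0) -> forall t, y t = 0.
Proof.
move=> chi_inj; move: {2}_.+1 (ltnSn #|[set t | y t != 0]|) => k.
elim: k y => // k IH y; rewrite ltnS => le_k sum0 t0; apply/eqP/negPn/negP => y0.
have supp1 s : s != t0 -> y s = 0.
  move=> st0; apply/eqP/negPn/negP => ys; case/eqP: st0; apply: chi_inj => a.
  pose y' t := y t * (chi t a - chi t0 a).
  have /(_ s)/eqP : forall t, y' t = 0.
    apply: IH => [|r].
      apply: leq_trans le_k.
      apply: proper_card; apply/properP; split.
        by apply/subsetP => t; rewrite !inE; apply: contraNneq; rewrite /y' => ->; rewrite mul0r.
      by exists t0; rewrite !inE // /y' subrr mulr0 eqxx.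
    transitivity (\sum_t y t * chi t (a * r) - chi t0 a * \sum_t y t * chi t r).
      rewrite mulr_sumr -sumrB; apply: eq_bigr => t _.
      by rewrite /y' rmorphM mulrBr mulrBl -!mulrA [in chi t0 a * _]mulrCA.
    by rewrite !sum0 mulr0 subrr.
  by rewrite mulf_eq0 (negPf ys) subr_eq0 => /eqP.
have := sum0 1; rewrite (bigD1 t0) //= big1 ?addr0 => [|s /supp1->]; last by rewrite mul0r.
by rewrite rmorph1 mulr1 => /eqP; rewrite (negPf y0).
Qed.

Section QuasiEigen.
Variables (F : closedFieldType) (n : nat).

(** This gives an eigenvector of the operator induced by [A] on the quotient of
    [V] by [V0].  The product of the [A - a], over the roots [a] of the
    characteristic polynomial, kills a vector outside [V0]; the last partial
    product that leaves it outside [V0] yields the eigenvector. *)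
Lemma eigenvector_modulo m0 m (A : 'M[F]_n) (V0 : 'M_(m0, n)) (V : 'M_(m, n)) :
  (V *m A <= V)%MS -> ~~ (V <= V0)%MS ->
  exists2 g : 'rV_n, (g <= V)%MS && ~~ (g <= V0)%MS &
    exists a, (g *m A - a *: g <= V0)%MS.
Proof.
move=> VA /row_subPn[i gV0]; move: (row i V) (row_sub i V) gV0 => {i}.
case: n A V0 V VA => [|n'] A V0 V VA g gV gV0.
  by case/negP: gV0; rewrite [g]thinmx0 sub0mx.
have [rs] := closed_field_poly_normal (char_poly A).
rewrite (monicP (char_poly_monic A)) scale1r => Ers.
have: (g *m \prod_(a <- rs) (A - a%:M) <= V0)%MS.
  have -> : \prod_(a <- rs) (A - a%:M) = horner_mx A (char_poly A).
    rewrite Ers rmorph_prod; apply: eq_bigr => a _.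
    by rewrite rmorphB /= horner_mx_X horner_mx_C.
  by rewrite Cayley_Hamilton mulmx0 sub0mx.
elim: rs {Ers} g gV gV0 => [|a rs IH] g gV gV0.
  by rewrite big_nil mulmx1 (negPf gV0).
rewrite big_cons -[_ * _]/(_ *m _) mulmxA => gP.
have Eg : g *m (A - a%:M) = g *m A - a *: g by rewrite mulmxBr mul_mx_scalar.
have [g1V0|g1V0] := boolP (g *m (A - a%:M) <= V0)%MS.
  by exists g; rewrite ?gV //; exists a; rewrite -Eg.
apply: IH gP => //; rewrite Eg addmx_sub ?eqmx_opp ?scalemx_sub //.
exact: submx_trans (submxMr _ gV) VA.
Qed.

Lemma common_eigenvector_modulo m0 m (As : seq 'M[F]_n) (V0 : 'M_(m0, n))
    (V : 'M_(m, n)) :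
  {in As &, forall A B, A *m B = B *m A} ->
  {in As, forall A, (V0 *m A <= V0)%MS} ->
  {in As, forall A, (V *m A <= V)%MS} -> ~~ (V <= V0)%MS ->
  exists2 g : 'rV_n, (g <= V)%MS && ~~ (g <= V0)%MS &
    {in As, forall A, exists a, (g *m A - a *: g <= V0)%MS}.
Proof.
elim: As m V => [|A As IH] m V comAs V0As VAs nV.
  have /row_subPn[i gV0] := nV.
  by exists (row i V) => //; rewrite row_sub.
have AAs : A \in A :: As by rewrite mem_head.
have [g /andP[gV gV0] [a ga]] := eigenvector_modulo (VAs _ AAs) nV.
pose V1 := (V :&: kermx ((A - a%:M) *m cokermx V0))%MS.
have V1P m1 (W : 'M_(m1, n)) :
    (W <= V1)%MS = (W <= V)%MS && (W *m (A - a%:M) <= V0)%MS.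
  by rewrite sub_capmx; congr andb; apply/sub_kermxP/idP;
    rewrite mulmxA submxE => /eqP.
have := submx_refl V1; rewrite V1P => /andP[V1V V1V0].
have subAs B : B \in As -> B \in A :: As by rewrite inE orbC => ->.
have [|B BAs|B BAs||h] := IH _ V1.
- by move=> B C BAs CAs; apply: comAs; apply: subAs.
- exact/V0As/subAs.
- rewrite V1P (submx_trans (submxMr _ V1V)) ?VAs ?subAs //=.
  have -> : V1 *m B *m (A - a%:M) = V1 *m (A - a%:M) *m B.
    rewrite -!mulmxA; congr (_ *m _).
    by rewrite mulmxBr mulmxBl (comAs A B AAs (subAs _ BAs)) scalar_mxC.
  by apply: submx_trans (submxMr _ V1V0) (V0As _ (subAs _ BAs)).
- apply: contraNN gV0 => V1V0'; apply: submx_trans V1V0'; rewrite V1P gV /=.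
  by rewrite mulmxBr mul_mx_scalar.
case/andP; rewrite V1P => /andP[hV hA] hV0 hAs; exists h; first by rewrite hV.
move=> B; rewrite inE => /orP[/eqP->|]; last exact: hAs.
by exists a; rewrite -mul_mx_scalar -mulmxBr.
Qed.

Variables (R : finComNzRingType) (N : R -> 'M[F]_n).
Hypotheses (ND : forall r s, N (r + s) = N r + N s)
  (NM : forall r s, N (r * s) = N r *m N s) (N1 : N 1 = 1%:M).

(** A common eigenvector of the ring action on the quotient of [V] by [V0] has
    unique eigenvalues, which therefore depend on [r] through a ring morphism. *)
Lemma quasi_eigen_character m0 m (V0 : 'M_(m0, n)) (V : 'M_(m, n)) :
  (forall r, (V0 *m N r <= V0)%MS) -> (forall r, (V *m N r <= V)%MS) ->
  ~~ (V <= V0)%MS ->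
  exists (g : 'rV_n) (chi : {rmorphism R -> F}),
    [/\ (g <= V)%MS, ~~ (g <= V0)%MS &
     forall r, (g *m N r - chi r *: g <= V0)%MS].
Proof.
move=> V0N VN nV.
have [| | | |g /andP[gV gV0] gN] := @common_eigenvector_modulo m0 m [seq N r | r : R] V0 V.
- by move=> _ _ /imageP[r _ ->] /imageP[s _ ->]; rewrite -!NM mulrC.
- by move=> _ /imageP[r _ ->].
- by move=> _ /imageP[r _ ->].
- by [].
have [r|f fP] := @fin_all_exists R (fun=> F)
  (fun r a => (g *m N r - a *: g <= V0)%MS).
  by apply: gN; apply: image_f.
have funiq r a : (g *m N r - a *: g <= V0)%MS -> f r = a.
  move=> ra; apply/eqP; rewrite eq_sym -subr_eq0; apply: contraNT gV0 => nz.
  rewrite -(eqmx_scale _ nz).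
  have -> : (a - f r) *: g = (g *m N r - f r *: g) - (g *m N r - a *: g).
    by rewrite scalerBl opprB [RHS]addrC addrA subrK.
  by rewrite addmx_sub ?eqmx_opp.
have fD : zmod_morphism f.
  move=> r s; apply: funiq; have -> : N (r - s) = N r - N s.
    by apply/eqP; rewrite eq_sym subr_eq -ND subrK.
  have -> : g *m (N r - N s) - (f r - f s) *: g =
    (g *m N r - f r *: g) - (g *m N s - f s *: g).
    by rewrite mulmxBr scalerBl !opprD !opprK addrACA.
  by rewrite addmx_sub ?eqmx_opp.
have fM : monoid_morphism f.
  split; first by apply: funiq; rewrite N1 mulmx1 scale1r subrr sub0mx.
  move=> r s; apply: funiq; rewrite NM mulmxA.
  have -> : g *m N r *m N s - (f r * f s) *: g =
    (g *m N r - f r *: g) *m N s + f r *: (g *m N s - f s *: g).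
    by rewrite mulmxBl scalerBr scalemxAl addrA scalerA -scalemxAl subrK.
  rewrite addmx_sub ?scalemx_sub //; apply: submx_trans (V0N s).
  exact: submxMr.
pose chi : {rmorphism R -> F} := HB.pack f
  (GRing.isZmodMorphism.Build _ _ f fD) (GRing.isMonoidMorphism.Build _ _ f fM).
by exists g, chi; split.
Qed.

End QuasiEigen.

(** * The characteristic polynomial of the generic element *)

Definition linear_form (S : nzRingType) n (v : 'I_n -> S) : {mpoly S[n]} :=
  \sum_(i < n) v i *: 'X_i.

(** The matrix of multiplication by the generic element, when [M i] is the
    matrix of multiplication by the i-th basis element. *)
Definition generic_matrix (S : comNzRingType) n m (M : 'I_n -> 'M[S]_m) :
    'M[{mpoly S[n]}]_m :=
  \sum_(i < n) 'X_i *: map_mx (@mpolyC n S) (M i).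

Lemma map_linear_form (S S' : nzRingType) n (f : {rmorphism S -> S'})
    (v : 'I_n -> S) :
  map_mpoly f (linear_form v) = linear_form (f \o v).
Proof.
rewrite rmorph_sum; apply: eq_bigr => i _.
by rewrite /= map_mpolyZ map_mpolyX.
Qed.

Lemma linear_form_inj (S : nzRingType) n (v w : 'I_n -> S) :
  linear_form v = linear_form w -> v =1 w.
Proof.
move=> vw i.
have coef u : (linear_form u)@_U_(i) = u i.
  rewrite raddf_sum (bigD1 i) //= mcoeffZ mcoeffXU eqxx mulr1 big1 ?addr0 // => j ji.
  by rewrite mcoeffZ mcoeffXU (negPf ji) mulr0.
by rewrite -!coef vw.
Qed.

Lemma map_generic_matrix (S S' : comNzRingType) n m (f : {rmorphism S -> S'})
    (M : 'I_n -> 'M[S]_m) :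
  map_mx (map_mpoly f) (generic_matrix M)
  = generic_matrix (fun i => map_mx f (M i)).
Proof.
rewrite map_mx_sum; apply: eq_bigr => i _.
apply/matrixP => j k; rewrite !mxE.
by rewrite /= rmorphM /= map_mpolyX map_mpolyC.
Qed.

Lemma char_poly_intertwined (D : idomainType) m (P A B : 'M[D]_m) :
  \det P != 0 -> P *m A = B *m P -> char_poly A = char_poly B.
Proof.
move=> detP PA; pose P' := map_mx (@polyC D) P.
have PA' : P' *m char_poly_mx A = char_poly_mx B *m P'.
  by rewrite /char_poly_mx mulmxBr mulmxBl -!map_mxM PA scalar_mxC.
have detP' : \det P' != 0 by rewrite det_map_mx polyC_eq0.
apply: (mulfI detP'); have := congr1 determinant PA'.
by rewrite !det_mulmx [RHS]mulrC.
Qed.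

Section CoordinateRing.
Variables (p : nat) (R : finComNzRingType) (n : nat).
Variables (crd : {additive R -> 'rV['F_p]_n}) (b : 'I_n -> R).
Hypotheses (crd_inj : injective crd) (crdb : forall i, crd (b i) = delta_mx 0 i).

Definition of_crd (v : 'rV['F_p]_n) : R := \sum_i b i *+ v 0 i.

Lemma of_crdK v : crd (of_crd v) = v.
Proof.
rewrite raddf_sum [RHS]row_sum_delta; apply: eq_bigr => i _.
by rewrite raddfMn crdb -scaler_nat natr_Zp.
Qed.

Lemma crdK r : of_crd (crd r) = r.
Proof. by apply: crd_inj; rewrite of_crdK. Qed.

(** An additive map between rings of characteristic p is linear over F_p. *)
Lemma additive_crd (S : comNzRingType) (iota : {rmorphism 'F_p -> S})
    (f : {additive R -> S}) r :
  f r = \sum_i iota (crd r 0 i) * f (b i).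
Proof.
rewrite -[in LHS](crdK r) raddf_sum; apply: eq_bigr => i _.
by rewrite raddfMn -mulr_natl -[in RHS](natr_Zp (crd r 0 i)) rmorph_nat.
Qed.

(** The transpose of multiplication by [r]: it acts on the right on row vectors,
    read as linear functionals in the basis dual to [b]. *)
Definition mulmat (r : R) : 'M['F_p]_n := \matrix_(l, i) crd (b i * r) 0 l.

Lemma additive_mulmat (S : comNzRingType) (iota : {rmorphism 'F_p -> S})
    (f : {additive R -> S}) r :
  (\row_i f (b i)) *m map_mx iota (mulmat r) = \row_i f (b i * r).
Proof.
apply/rowP => i; rewrite !mxE (additive_crd iota).
by apply: eq_bigr => l _; rewrite !mxE mulrC.
Qed.

Lemma mulmatD r s : mulmat (r + s) = mulmat r + mulmat s.
Proof. by apply/matrixP => l i; rewrite !mxE mulrDr raddfD mxE. Qed.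

Lemma crd_mulr s r : (crd (s * r))^T = mulmat r *m (crd s)^T.
Proof.
apply/matrixP => l j; rewrite !mxE ord1.
pose f := (fun t => crd (t * r) 0 l).
have fD : zmod_morphism f by move=> t u; rewrite /f mulrBl raddfB !mxE.
pose F : {additive R -> 'F_p} :=
  HB.pack f (GRing.isZmodMorphism.Build _ _ f fD).
have := additive_crd idfun F s; rewrite /= /f => ->.
by apply: eq_bigr => k _; rewrite !mxE mulrC.
Qed.

Lemma mulmatM r s : mulmat (r * s) = mulmat r *m mulmat s.
Proof.
apply/matrixP => l i; rewrite mxE [r * s]mulrC mulrA.
have /matrixP/(_ l 0) := crd_mulr (b i * s) r; rewrite !mxE => ->.
by apply: eq_bigr => k _; rewrite !mxE.
Qed.

Lemma mulmat1 : mulmat 1 = 1%:M.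
Proof.
by apply/matrixP => l i; rewrite !mxE mulr1 crdb mxE eqxx.
Qed.

Variables (L : closedFieldType) (iota : {rmorphism 'F_p -> L}).
Local Notation N := (fun r => map_mx iota (mulmat r)).

(** The value of a character at the generic element. *)
Definition char_form (chi : R -> L) := linear_form (fun i => chi (b i)).

Lemma char_form_inj (chi psi : {rmorphism R -> L}) :
  char_form chi = char_form psi -> chi =1 psi.
Proof.
move=> /linear_form_inj eqb r; rewrite !(additive_crd iota) /=.
by apply: eq_bigr => i _; rewrite eqb.
Qed.

(** The rows of [P] are built one at a time, each an eigenvector modulo the span
    of the previous ones. *)
Lemma triangular_action k : (k <= n)%N ->
  exists (P : 'M[L]_(k, n)) (d : 'I_k -> {rmorphism R -> L}) (T : R -> 'M_k),
  [/\ row_free P, forall r, P *m N r = T r *m P, forall r, is_trig_mx (T r) &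
      forall r j, T r j j = d j r].
Proof.
have ND r s : N (r + s) = N r + N s by rewrite /= mulmatD map_mxD.
have NM r s : N (r * s) = N r *m N s by rewrite /= mulmatM map_mxM.
have N1 : N 1 = 1%:M by rewrite /= mulmat1 map_mx1.
elim: k => [_|k IH ltkn].
  exists 0, (fun j : 'I_0 => match j with Ordinal m i => False_rect _ (notF i) end),
    (fun=> 0); split => //.
  - by rewrite /row_free mxrank0.
  - by move=> r; rewrite !mul0mx.
  - by move=> r; apply/is_trig_mxP; case.
  - by move=> r; case.
have [P [d [T [Pfree PN Ttrig Td]]]] := IH (ltnW ltkn).
have [||| g [chi [_ gP gN]]] := @quasi_eigen_character L n R N ND NM N1 _ _ P 1%:M.
- by move=> r; rewrite PN submxMl.
- by move=> r; rewrite submx1.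
- apply: contraTN ltkn => /mxrankS; rewrite mxrank1 (eqP Pfree).
  by rewrite -leqNgt.
have [t tP] : exists t : R -> 'rV_k, forall r, g *m N r - chi r *: g = t r *m P.
  apply: (@fin_all_exists R (fun=> 'rV_k)
    (fun r t => g *m N r - chi r *: g = t *m P)) => r.
  exact/submxP/gN.
rewrite -addn1.
exists (col_mx P g), (fun j => match split j with inl i => d i | inr _ => chi end),
  (fun r => block_mx (T r) 0 (t r) (chi r)%:M); split.
- rewrite -row_leq_rank.
  have g0 : g != 0 by apply: contraNneq gP => ->; rewrite sub0mx.
  have Pg : (P :&: g)%MS = 0.
    apply/eqP; rewrite -mxrank_eq0.
    have : (\rank (P :&: g)%MS <= 1)%N.
      by rewrite (leq_trans (mxrankS (capmxSr _ _))) // rank_leq_row.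
    rewrite leq_eqVlt ltnS leqn0 => /orP[/eqP r1|//].
    case/negP: gP; apply: submx_trans (capmxSl P g).
    by rewrite -(mxrank_leqif_sup (capmxSr P g)) r1 rank_rV g0.
  have := mxrank_sum_cap P g; rewrite Pg mxrank0 addn0 -addsmxE => ->.
  by rewrite (eqP Pfree) rank_rV g0.
- move=> r; rewrite mul_col_mx mul_block_col PN mul0mx addr0 -tP mul_scalar_mx.
  by rewrite subrK.
- move=> r; rewrite is_trig_block_mx // eqxx Ttrig /=.
  by apply/is_trig_mxP => i j; rewrite !ord1.
- move=> r j; rewrite -{1 2}(splitK j); case: (split j) => i /=.
    by rewrite block_mxEul Td.
  by rewrite block_mxEdr !ord1 mxE.
Qed.

Theorem generic_char_poly_split :
  exists d : 'I_n -> {rmorphism R -> L},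
    char_poly (generic_matrix (fun i => N (b i)))
    = \prod_j ('X - (char_form (d j))%:P).
Proof.
have [P [d [T [Pfree PN Ttrig Td]]]] := triangular_action (leqnn n).
exists d; pose C := @mpolyC n L.
pose G := generic_matrix (fun i => N (b i)).
pose G' := generic_matrix (fun i => T (b i)).
have PG : map_mx C P *m G = G' *m map_mx C P.
  rewrite mulmx_sumr mulmx_suml; apply: eq_bigr => i _.
  by rewrite -scalemxAr -scalemxAl -!map_mxM PN.
have detP : \det (map_mx C P) != 0.
  rewrite det_map_mx mpolyC_eq0 -unitfE -unitmxE.
  by rewrite -row_free_unit.
rewrite (char_poly_intertwined detP PG).
rewrite char_poly_trig.
  apply: eq_bigr => j _; rewrite summxE; congr ('X - _%:P).
  by apply: eq_bigr => i _; rewrite !mxE Td mulrC mul_mpolyC.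
apply/is_trig_mxP => i j ij; rewrite summxE big1 // => k _.
by rewrite !mxE (is_trig_mxP (Ttrig _)) // mpolyC0 mulr0.
Qed.

(** The row of values of [chi] is a left eigenvector of the generic matrix. *)
Lemma root_generic_char_poly (chi : {rmorphism R -> L}) :
  root (char_poly (generic_matrix (fun i => N (b i)))) (char_form chi).
Proof.
pose C := @mpolyC n L.
rewrite rootE /char_poly -horner_evalE -det_map_mx.
apply/det0P; exists (map_mx C (\row_i chi (b i))).
  apply: contra_eqN (rmorph1 chi) => /eqP v0.
  rewrite (additive_crd iota) /= big1 => [|i _]; first by rewrite eq_sym oner_eq0.
  move/rowP/(_ i)/eqP: v0; rewrite !mxE mpolyC_eq0 => /eqP->.
  by rewrite mulr0.
have -> : map_mx (horner_eval (char_form chi)) (char_poly_mx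
    (generic_matrix (fun i => N (b i)))) = (char_form chi)%:M - generic_matrix (fun i => N (b i)).
  apply/matrixP => i j; rewrite !mxE !rmorphB /= /horner_eval hornerC.
  by rewrite !hornerMn hornerX.
rewrite mulmxBr mul_mx_scalar mulmx_sumr scaler_suml -sumrB big1 // => i _.
rewrite -scalemxAr -map_mxM additive_mulmat.
apply/rowP => j; rewrite !mxE.
rewrite /= (rmorphM chi) mpolyCM -[chi (b i) *: _]mul_mpolyC.
by rewrite -[X in X - _]mulrA [X in X - _]mulrC -[X in X - _]mulrA subrr.
Qed.

End CoordinateRing.

(** * Irreducible factors and Frobenius orbits of characters *)

Lemma dvd_prod_XsubC (D : idomainType) (f : {poly D}) (rs : seq D) :
  all (root f) rs -> uniq rs ->
  exists q, f = q * \prod_(z <- rs) ('X - z%:P).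
Proof.
elim: rs f => [|z rs IH] f /=; first by exists f; rewrite big_nil mulr1.
case/andP=> /factor_theorem[q ->] rts /andP[zrs urs].
have [|//|q' ->] := IH q.
  apply/allP => x xrs; have := allP rts x xrs.
  by rewrite rootM root_XsubC; case: eqP zrs => [<-|_]; rewrite ?xrs // orbF.
by exists q'; rewrite big_cons -mulrA [_ * ('X - _)]mulrC.
Qed.

(** The factorization argument works over a domain because the factors
    ['X - z] are prime there, and no unique factorization is assumed. *)
Lemma factor_prod_XsubC_root (D : idomainType) (f g : {poly D}) (rs : seq D) :
  f \is monic -> (1 < size f)%N -> f * g = \prod_(z <- rs) ('X - z%:P) ->
  exists2 z, z \in rs & root f z.
Proof.
move=> fmon f1; elim: rs g => [|z rs IH] g fg.
  have: f \is a GRing.unit.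
    by apply/unitrP; exists g; rewrite mulrC fg big_nil.
  by rewrite poly_unitE => /andP[/eqP f1']; rewrite f1' in f1.
have [fz|fz] := boolP (root f z); first by exists z; rewrite ?mem_head.
have: root (f * g) z by rewrite fg big_cons rootM root_XsubC eqxx.
rewrite rootM (negPf fz) => /factor_theorem[g' Eg].
have [|x xrs fx] := IH g'; last by exists x; rewrite ?inE ?xrs ?orbT.
apply: (mulIf (negbT (polyXsubC_eq0 z))); rewrite -mulrA -Eg fg big_cons.
by rewrite mulrC.
Qed.

Lemma Fp_fermat p (c : 'F_p) : prime p -> c ^+ p = c.
Proof. by move=> p_pr; have := expf_card c; rewrite card_Fp. Qed.

Section Frobenius.
Variables (p : nat) (p_pr : prime p) (L : closedFieldType).
Variable (iota : {rmorphism 'F_p -> L}).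

Lemma pchar_closure : p \in [pchar L].
Proof. by rewrite (fmorph_pchar iota) pchar_Fp. Qed.

Local Notation phi := (pFrobenius_aut pchar_closure).

(** The elements of F_p are already p roots of ['X^p - 'X]. *)
Lemma frobenius_fixed x : x ^+ p = x -> exists c, x = iota c.
Proof.
move=> xp; pose rs := [seq iota c | c : 'F_p].
have rsP : x \in rs -> exists c, x = iota c by case/imageP => c _ ->; exists c.
apply: rsP; apply/negPn/negP => xrs.
have szX : size ('X^p - 'X : {poly L}) = p.+1.
  by rewrite size_polyDl size_polyXn // size_polyN size_polyX ltnS prime_gt1.
have nz : 'X^p - 'X != 0 :> {poly L} by rewrite -size_poly_gt0 szX.
have rt y : root ('X^p - 'X) y = (y ^+ p == y).
  by rewrite rootE !hornerE hornerXn subr_eq0.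
have /(max_poly_roots nz) : all (root ('X^p - 'X)) (x :: rs).
  rewrite /= rt xp eqxx; apply/allP => _ /imageP[c _ ->].
  by rewrite rt -rmorphXn Fp_fermat.
rewrite szX /= size_image card_Fp // ltnn xrs => nu; suff: false by []; apply: nu.
by rewrite map_inj_uniq ?enum_uniq //; apply: fmorph_inj.
Qed.

Lemma mpoly_descent n (f : {mpoly L[n]}) :
  map_mpoly phi f = f -> exists f0, f = map_mpoly iota f0.
Proof.
move=> fixf; rewrite [f]mpolyE.
apply: (big_ind (fun f => exists f0, f = map_mpoly iota f0)).
- by exists 0; rewrite rmorph0.
- by move=> _ _ [f0 ->] [g0 ->]; exists (f0 + g0); rewrite rmorphD.
move=> m _; have [|c ->] := @frobenius_fixed f@_m.
  by rewrite -{2}fixf mcoeff_map_mpoly.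
by exists (c *: 'X_[m]); rewrite map_mpolyZ map_mpolyX.
Qed.

Lemma poly_mpoly_descent n (P : {poly {mpoly L[n]}}) :
  map_poly (map_mpoly phi) P = P ->
  exists P0, P = map_poly (map_mpoly iota) P0.
Proof.
move=> fixP; rewrite -[P]coefK poly_def.
apply: (big_ind (fun f => exists f0, f = map_poly (map_mpoly iota) f0)).
- by exists 0; rewrite rmorph0.
- by move=> _ _ [f0 ->] [g0 ->]; exists (f0 + g0); rewrite rmorphD.
move=> [i /= _] _; have [|c ->] := @mpoly_descent n P`_i.
  by rewrite -{2}fixP coef_map.
by exists (c *: 'X^i); rewrite linearZ_LR /= map_polyXn.
Qed.

End Frobenius.

Section Orbits.
Variables (p : nat) (p_pr : prime p) (R : finComNzRingType) (n : nat).
Variables (crd : {additive R -> 'rV['F_p]_n}) (b : 'I_n -> R).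
Hypotheses (crd_inj : injective crd) (crdb : forall i, crd (b i) = delta_mx 0 i).
Variables (L : closedFieldType) (iota : {rmorphism 'F_p -> L}).

(** The diagonal characters [d j] may repeat; [T] keeps the first index of each
    class of equal characters, and is a complete list of characters since each
    one is a root of the generic characteristic polynomial. *)
Lemma finite_characters :
  exists (T : finType) (ev : T -> {rmorphism R -> L}) (d : 'I_n -> T),
  [/\ forall s t, ev s =1 ev t -> s = t,
      forall chi : {rmorphism R -> L}, exists t, ev t =1 chi,
      forall t, exists j, d j = t &
    char_poly (generic_matrix (fun i => map_mx iota (mulmat crd b (b i))))
    = \prod_j ('X - (char_form b (ev (d j)))%:P)].
Proof.
have [d Ed] := generic_char_poly_split crd_inj crdb iota.
pose same i j := [forall r, d i r == d j r].
have sameP i j : reflect (d i =1 d j) (same i j) by exact/eqfunP.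
pose P (j : 'I_n) := [forall i : 'I_n, (i < j)%N ==> ~~ same i j].
pose T : finType := {j | P j}.
pose ev (t : T) := d (val t).
have rep j : exists t, ev t =1 d j.
  have: same j j by apply/sameP.
  case/(arg_minnP (fun i : 'I_n => val i)) => i /sameP ij imin.
  have Pi : P i.
    apply/forallP => k; apply/implyP => ki; apply: contraL ki => /sameP ki.
    by rewrite -leqNgt imin //; apply/sameP => r; rewrite ki ij.
  by exists (Sub i Pi); rewrite /ev SubK.
have ev_inj s t : ev s =1 ev t -> s = t.
  move=> st; apply/val_inj/val_inj/eqP; rewrite eqn_leq.
  apply/andP; split; rewrite leqNgt; apply/negP => lt.
    have /forallP/(_ (val t))/implyP/(_ lt)/negP[] := valP s.
    by apply/sameP => r; apply/esym/st.
  have /forallP/(_ (val s))/implyP/(_ lt)/negP[] := valP t.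
  exact/sameP.
have [e eP] := @fin_all_exists _ (fun=> T) (fun j t => ev t =1 d j) rep.
have exd (chi : {rmorphism R -> L}) : exists j, d j =1 chi.
  have := root_generic_char_poly crd_inj crdb iota chi.
  rewrite Ed -(big_map (fun j => char_form b (d j)) xpredT (fun z => 'X - z%:P)).
  rewrite root_prod_XsubC => /mapP[j _ Echi].
  by exists j => r; rewrite (char_form_inj crd_inj crdb iota Echi).
exists T, ev, e; split; first exact: ev_inj.
- by move=> chi; have [j dj] := exd chi; exists (e j) => r; rewrite eP dj.
- by move=> t; exists (val t); apply: ev_inj => r; rewrite eP.
rewrite Ed; apply: eq_bigr => j _; congr ('X - _%:P).
by apply: eq_bigr => i _; rewrite eP.
Qed.

Variables (T : finType) (ev : T -> {rmorphism R -> L}).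
Hypotheses (ev_inj : forall s t, ev s =1 ev t -> s = t)
  (ev_surj : forall chi : {rmorphism R -> L}, exists t, ev t =1 chi).
Local Notation phi := (pFrobenius_aut (pchar_closure p_pr iota)).

Lemma frobenius_permutation :
  exists frob : T -> T, forall t r, ev (frob t) r = ev t r ^+ p.
Proof.
apply: (@fin_all_exists _ (fun=> T) (fun t u => forall r, ev u r = ev t r ^+ p)) => t.
by have [u uP] := ev_surj (phi \o ev t); exists u => r; rewrite uP.
Qed.

Variable (frob : T -> T).
Hypothesis frobE : forall t r, ev (frob t) r = ev t r ^+ p.

Lemma frob_inj : injective frob.
Proof.
move=> s t st; apply: ev_inj => r; apply: (fmorph_inj phi).
by rewrite /= !pFrobenius_autE -!frobE st.
Qed.

Local Notation cf t := (char_form b (ev t)).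

Lemma cf_inj s t : cf s = cf t -> s = t.
Proof. by move=> /(char_form_inj crd_inj crdb iota)/ev_inj. Qed.

Lemma frob_cf t : map_mpoly phi (cf t) = cf (frob t).
Proof.
by rewrite map_linear_form; apply: eq_bigr => i _; rewrite /= frobE.
Qed.

Local Notation lift := (map_poly (map_mpoly iota)).

Lemma lift_inj : injective (lift : {poly {mpoly 'F_p[n]}} -> {poly {mpoly L[n]}}).
Proof.
move=> f g fg; apply/polyP => i; apply/mpolyP => m.
have /(congr1 (fun q : {poly {mpoly L[n]}} => (q`_i)@_m)) := fg.
by rewrite !coef_map !mcoeff_map_mpoly => /fmorph_inj.
Qed.

Lemma size_lift (f : {poly {mpoly 'F_p[n]}}) : size (lift f) = size f.
Proof.
apply: size_map_inj_poly; rewrite ?rmorph0 // => u v uv; apply/mpolyP => m.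
by have /(congr1 (mcoeff m)) := uv; rewrite !mcoeff_map_mpoly => /fmorph_inj.
Qed.

Lemma phi_lift (f : {poly {mpoly 'F_p[n]}}) : map_poly (map_mpoly phi) (lift f) = lift f.
Proof.
apply/polyP => i; apply/mpolyP => m.
by rewrite !coef_map !mcoeff_map_mpoly /= pFrobenius_autE -rmorphXn Fp_fermat.
Qed.

Definition orbit_poly t := \prod_(s | fconnect frob t s) ('X - (cf s)%:P).

Lemma phi_orbit_poly t : map_poly (map_mpoly phi) (orbit_poly t) = orbit_poly t.
Proof.
rewrite [RHS](reindex_inj frob_inj) rmorph_prod; apply: eq_big => s.
  by rewrite (same_fconnect1_r frob_inj).
by rewrite rmorphB /= map_polyX map_polyC /= frob_cf.
Qed.

Lemma orbit_polyE t :
  orbit_poly t = \prod_(z <- [seq cf s | s <- enum (fconnect frob t)]) ('X - z%:P).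
Proof. by rewrite big_map big_enum. Qed.

Lemma size_orbit_poly t : size (orbit_poly t) = (fingraph.order frob t).+1.
Proof. by rewrite orbit_polyE size_prod_XsubC size_map -cardE. Qed.

Lemma root_orbit_poly t s : root (orbit_poly t) (cf s) = fconnect frob t s.
Proof.
rewrite orbit_polyE root_prod_XsubC mem_map ?mem_enum //.
by move=> u v; apply: cf_inj.
Qed.

(** The factor [f] is fixed by Frobenius, so it vanishes on the whole orbit of
    [t] and is divisible by the orbit polynomial.  That polynomial and the
    quotient are fixed by Frobenius, hence defined over F_p, and irreducibility
    of [f] leaves no room for a quotient other than 1. *)
Lemma irreducible_orbit (f : {poly {mpoly 'F_p[n]}}) t :
  f \is monic -> irreducible_element f -> root (lift f) (cf t) ->
  lift f = orbit_poly t.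
Proof.
move=> fmon [_ _ firr] ft.
have rts s : fconnect frob t s -> root (lift f) (cf s).
  move/iter_findex <-; elim: (findex frob t s) => [|k] //=.
  set u := iter k frob t => fu.
  by rewrite -frob_cf -(phi_lift f) rootE horner_map (rootP fu) rmorph0.
have [||q Eq] := @dvd_prod_XsubC _ (lift f) [seq cf s | s <- enum (fconnect frob t)].
- by apply/allP => _ /mapP[s + ->]; rewrite mem_enum => /rts.
- by rewrite map_inj_uniq ?enum_uniq // => u v; apply: cf_inj.
rewrite -orbit_polyE in Eq.
have omon : orbit_poly t \is monic by rewrite orbit_polyE monic_prod_XsubC.
have [h0 Eh] := poly_mpoly_descent (phi_orbit_poly t).
have [|q0 Eq0] := @poly_mpoly_descent p p_pr L iota n q.
  apply: (mulIf (monic_neq0 omon)); rewrite -Eq -(phi_orbit_poly t).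
  by rewrite -rmorphM -Eq; apply: phi_lift.
have fE : f = q0 * h0 by apply: lift_inj; rewrite Eq Eh Eq0 rmorphM.
have unit1 (g : {poly {mpoly 'F_p[n]}}) : g \is a GRing.unit -> size g = 1 :> nat.
  by rewrite poly_unitE => /andP[/eqP].
have [/unit1 q1|/unit1 h1] := firr _ _ fE; last first.
  have := size_orbit_poly t; rewrite Eh size_lift h1 => -[] /esym/eqP.
  by rewrite -leqn0 leqNgt fingraph.order_gt0.
have h0mon : h0 \is monic.
  apply/monicP/mpolyP => m; apply: (fmorph_inj iota).
  have /monicP/(congr1 (mcoeff m)) := omon.
  rewrite Eh lead_coefE coef_map size_lift -lead_coefE mcoeff_map_mpoly => ->.
  by rewrite !mcoeff1 rmorph_nat.
have q0mon : q0 \is monic by rewrite -(monicMr q0 h0mon) -fE.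
suff q01 : q0 = 1 by rewrite fE q01 mul1r -Eh.
move: (q0mon); rewrite monicE lead_coefE q1 /= => /eqP q00.
by rewrite (size1_polyC (eq_leq q1)) q00.
Qed.

(** The characters [tt j] represent the orbits: each factor determines one orbit,
    distinct factors determine distinct orbits, and all orbits are reached. *)
Lemma irreducible_factors_orbits (h : nat) (FF : 'I_h -> {poly {mpoly 'F_p[n]}})
    (delta : 'I_h -> nat) (m : nat) (d : 'I_m -> T) :
  injective FF -> (forall j, FF j \is monic) ->
  (forall j, irreducible_element (FF j)) -> (forall j, (0 < delta j)%N) ->
  lift (\prod_j FF j ^+ delta j) = \prod_j ('X - (cf (d j))%:P) ->
  (forall t, exists j, d j = t) ->
  exists tt : 'I_h -> T,
  [/\ forall j, size (FF j) = (fingraph.order frob (tt j)).+1,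
      forall i j, fconnect frob (tt i) (tt j) -> i = j &
      forall t, exists j, fconnect frob (tt j) t].
Proof.
move=> FFinj FFmon FFirr delta0 EF dsurj.
have liftmon (f : {poly {mpoly 'F_p[n]}}) : f \is monic -> lift f \is monic by apply: monic_map.
have rt j : exists t, root (lift (FF j)) (cf t).
  have [||_ /mapP[i _ ->] rj] := @factor_prod_XsubC_root _ (lift (FF j))
     (lift (FF j ^+ (delta j).-1 * \prod_(i | i != j) FF i ^+ delta i))
     [seq cf (d i) | i : 'I_m] (liftmon _ (FFmon j)); last by exists (d i).
    rewrite size_lift ltnNge; apply/negP => szj; have [_ /negP nu _] := FFirr j; apply: nu.
    have := monicP (FFmon j); rewrite (size1_polyC szj) lead_coefC => ->.
    exact: unitr1.
  rewrite -rmorphM mulrA -exprS prednK // big_map big_enum -EF.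
  by rewrite [in RHS](bigD1 j).
have [tt ttP] := @fin_all_exists _ (fun=> T) (fun j t => root (lift (FF j)) (cf t)) rt.
have ttE j : lift (FF j) = orbit_poly (tt j) by apply: irreducible_orbit.
exists tt; split.
- by move=> j; rewrite -size_orbit_poly -ttE size_lift.
- move=> i j ij; apply: FFinj; apply: lift_inj; rewrite !ttE.
  by apply: eq_bigl => s; rewrite (same_connect (fconnect_sym frob_inj) ij).
move=> t; have : root (lift (\prod_j FF j ^+ delta j)) (cf t).
  rewrite EF; have [j <-] := dsurj t.
  by rewrite (bigD1 j) //= rootM root_XsubC eqxx.
rewrite rmorph_prod /= => rt_t.
have [j] : exists j, root (lift (FF j)) (cf t).
  apply/existsP; move: rt_t; apply: contraLR; rewrite negb_exists => /forallP nrt.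
  rewrite rootE horner_prod prodf_seq_neq0; apply/allP => j _ /=.
  by rewrite rmorphXn /= horner_exp expf_neq0 // -rootE.
by rewrite ttE root_orbit_poly; exists j.
Qed.

End Orbits.

Lemma card_order_representatives (T : finType) (f : T -> T) (h : nat)
    (tt : 'I_h -> T) k : injective f ->
  (forall i j, fconnect f (tt i) (tt j) -> i = j) ->
  (forall t, exists j, fconnect f (tt j) t) ->
  #|[set t | fingraph.order f t == k]|
  = (k * #|[set j | fingraph.order f (tt j) == k]|)%N.
Proof.
move=> finj ttinj ttsurj.
have [J JP] := @fin_all_exists _ (fun=> 'I_h) (fun t j => fconnect f (tt j) t) ttsurj.
have Juniq t j : fconnect f (tt j) t = (J t == j).
  apply/idP/eqP => [jt|<- //]; apply: ttinj.
  by apply: connect_trans (JP t) _; rewrite fconnect_sym.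
have order_eq s t : fconnect f s t -> fingraph.order f t = fingraph.order f s.
  by move=> st; apply: eq_card => u; rewrite !inE (same_connect (fconnect_sym finj) st).
rewrite -sum1_card (partition_big J (mem [set j | fingraph.order f (tt j) == k])) /=.
  rewrite mulnC -sum_nat_const; apply: eq_bigr => j; rewrite inE => /eqP jk.
  rewrite -[RHS]jk -[RHS]sum1_card; apply: eq_bigl => t.
  by rewrite !inE -Juniq andb_idl // => /order_eq->; rewrite jk.
by move=> t; rewrite !inE => /eqP <-; rewrite (order_eq _ _ (JP t)).
Qed.

(** * Orbits of bijections and equivariant injections *)

Lemma iter_modn (X : Type) (g : X -> X) k x i :
  iter k g x = x -> iter i g x = iter (i %% k) g x.
Proof.
move=> kx; rewrite {1}(divn_eq i k) addnC iterD; congr (iter _ _ _).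
by elim: (i %/ k)%N => //= q IH; rewrite mulSn iterD IH.
Qed.

(** The periods of a point are closed under gcd, by Bezout. *)
Lemma iter_gcdn (X : Type) (g : X -> X) m k x : (0 < m)%N ->
  iter m g x = x -> iter k g x = x -> iter (gcdn m k) g x = x.
Proof.
move=> m0 mx kx; case: (egcdnP k m0) => km kn E _.
have := iter_modn (km * m) mx; rewrite modnMl /= E addnC iterD.
by rewrite (iter_modn (kn * k) kx) modnMl.
Qed.

Definition exact_period (X : eqType) (g : X -> X) k x :=
  [&& (0 < k)%N, iter k g x == x & all (fun m => iter m g x != x) (iota 1 k.-1)].

Lemma exact_periodP (X : eqType) (g : X -> X) k x :
  reflect [/\ (0 < k)%N, iter k g x = x &
             forall m, (m < k)%N -> iter m g x = x -> m = 0%N]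
          (exact_period g k x).
Proof.
apply: (iffP and3P) => [[k0 /eqP kx /allP allm]|[k0 kx minx]].
  split=> // -[|m] // mk mx; have := allm m.+1.
  by rewrite mem_iota add1n prednK // mk mx eqxx => /(_ isT).
split=> //; first by rewrite kx.
apply/allP => m; rewrite mem_iota add1n prednK // => /andP[m0 mk].
by apply: contraL m0 => /eqP/(minx _ mk) ->.
Qed.

Lemma exact_period_order (T : finType) (f : T -> T) k t : injective f ->
  exact_period f k t = (fingraph.order f t == k).
Proof.
move=> finj; apply/exact_periodP/eqP => [[k0 kt mint]|<-]; last first.
  split; rewrite ?fingraph.order_gt0 ?iter_order // => m mt mE.
  by rewrite -(findex_iter mt) mE findex0.
have [lt|gt|//] := ltngtP (fingraph.order f t) k.
  by have := mint _ lt (iter_order finj t) => E; have := fingraph.order_gt0 f t; rewrite E.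
by move: k0; rewrite -(findex_iter gt) kt findex0.
Qed.

(** An injection is extended orbit by orbit.  If [t] is outside the domain of a
    partial injection and has period k, then [D k] has a point [x] that is not
    the image of a point of period k; the whole orbit of [x] is then disjoint
    from the image, and the orbit of [t] can be sent onto it. *)
Lemma equivariant_injection (T : finType) (f : T -> T) (X : eqType) (g : X -> X)
    (D : nat -> seq X) :
  injective f -> injective g -> (forall k, uniq (D k)) ->
  (forall k x, (x \in D k) = exact_period g k x) ->
  (forall k, (#|[set t | fingraph.order f t == k]| <= size (D k))%N) ->
  exists2 c : T -> X, injective c & forall t, c (f t) = g (c t).
Proof.
move=> finj ginj uD memD leD.
have x0 (t : T) : X.
  case: (D (fingraph.order f t)) (leD (fingraph.order f t)) => [|x _ _] //.
  by rewrite leqn0 cards_eq0 => /eqP/setP/(_ t); rewrite !inE eqxx.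
suff ext N (A : {set T}) (c : T -> X) : (#|~: A| <= N)%N ->
    {in A, forall t, f t \in A} -> {in A &, injective c} ->
    {in A, forall t, c (f t) = g (c t)} ->
    exists2 c : T -> X, injective c & forall t, c (f t) = g (c t).
  by apply: (ext _ set0 x0 (leqnn _)) => t; rewrite ?inE // => ?; rewrite inE.
elim: N A c => [|N IH] A c leN Af cinj cf.
  have AT t : t \in A 
    by move: leN; rewrite leqn0 cards_eq0 => /eqP A0; apply/negPn; rewrite -in_setC A0 inE.
  by exists c => [s t|t]; [apply: cinj | apply: cf].
have [A0|[t]] := set_0Vmem (~: A); first by apply: (IH A c); rewrite ?A0 ?cards0.
rewrite inE => tA; pose k := fingraph.order f t.
have Ai i s : s \in A -> iter i f s \in A by move=> sA; elim: i => //= i; apply: Af.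
have ci i s : s \in A -> c (iter i f s) = iter i g (c s).
  by move=> sA; elim: i => //= i <-; rewrite cf ?Ai.
have cper s j : s \in A -> exact_period g j (c s) = (fingraph.order f s == j).
  move=> sA; rewrite -exact_period_order //; rewrite /exact_period -ci //.
  rewrite (inj_in_eq cinj) ?Ai //; congr [&& _, _ & _]; apply: eq_all => m.
  by rewrite -ci // (inj_in_eq cinj) ?Ai.
pose Ak := [seq c s | s <- enum [set s in A | fingraph.order f s == k]].
have [x xk xAk] : exists2 x, x \in D k & x \notin Ak.
  apply/hasP; apply/negPn/negP => /hasPn nx.
  have sub : {subset D k <= Ak} by move=> x /nx/negPn.
  have := leq_trans (leD k) (uniq_leq_size (uD k) sub).
  rewrite size_map -cardE leqNgt => /negP[]; apply: proper_card.
  apply/properP; split; first by apply/subsetP => s; rewrite !inE => /andP[].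
  by exists t; rewrite !inE ?eqxx // (negPf tA).
move: xk; rewrite memD => /exact_periodP[k0 kx minx].
pose c' s := if fconnect f t s then iter (findex f t s) g x else c s.
have c'i i : c' (iter i f t) = iter i g x.
  rewrite /c' fconnect_iter (iter_modn i (iter_order finj t)) findex_iter.
    by rewrite (iter_modn i kx).
  by rewrite ltn_mod.
have orbA s : fconnect f t s -> s \notin A.
  move=> ts; apply: contra tA => sA; have := ts; rewrite fconnect_sym //.
  by move/iter_findex <-; apply: Ai.
have c'A s : s \in A -> c' s = c s.
  by rewrite /c'; case: ifP => // /orbA /negPf->.
(* the new orbit avoids the image of A *)
have key i s : s \in A -> iter i g x <> c s.
  move=> sA E; pose j := (k - i %% k)%N.
  have Ej : x = c (iter j f s).
    rewrite ci // -E (iter_modn i kx) -iterD subnK ?kx //.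
    by rewrite ltnW // ltn_mod.
  case/negP: xAk; apply/mapP; exists (iter j f s); last by [].
  by rewrite mem_enum inE Ai //= -cper ?Ai // -Ej; apply/exact_periodP.
pose A' := A :|: [set s | fconnect f t s].
have A'P s : s \in A' -> s \in A \/ exists2 i, (i < k)%N & s = iter i f t.
  rewrite !inE => /orP[|ts]; [by left | right].
  by exists (findex f t s); rewrite ?iter_findex ?findex_max.
apply: (IH A' c').
- rewrite -ltnS; apply: leq_trans leN; apply: proper_card; apply/properP; split.
    by apply/subsetP => s; rewrite !inE negb_or => /andP[].
  by exists t; rewrite !inE ?tA // connect0 orbT.
- move=> s /A'P[sA|[i _ ->]]; first by rewrite !inE Af.
  by rewrite -iterS !inE fconnect_iter orbT.
- move=> s u /A'P[sA|[i ik ->]] /A'P[uA|[j jk ->]]; rewrite ?c'i ?c'A //.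
  + exact: cinj.
  + by move=> E; case: (key j s sA (esym E)).
  + by move=> E; case: (key i u uA E).
  have {s u}main i' j' : (i' <= j' < k)%N -> iter i' g x = iter j' g x -> i' = j'.
    move=> /andP[ij jk']; rewrite -(subnKC ij) iterD => E.
    have {}E : x = iter (j' - i') g x.
      by move: (j' - i')%N E => m; elim: (i') => //= l IHl /ginj.
    rewrite (minx (j' - i')%N) ?addn0 //; exact: leq_ltn_trans (leq_subr _ _) jk'.
  by case: (leqP i j) => [ij|/ltnW ij] E; congr (iter _ _ _);
    [apply: main | apply/esym/main]; rewrite ?ij ?jk ?ik.
- move=> s /A'P[sA|[i _ ->]]; first by rewrite !c'A ?cf ?Af.
  by rewrite -iterS !c'i.
Qed.

(** The primes in [S] are distinct, hence pairwise coprime. *)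
Lemma dvd_prod_primes k (S : {set 'I_k.+1}) m :
  {in S, forall q, prime (val q)} ->
  (\prod_(q in S) val q %| m)%N = [forall q in S, val q %| m]%N.
Proof.
move=> Sprime.
have cop (q r : 'I_k.+1) : q \in S -> r \in S -> q != r -> coprime q r.
  by move=> /Sprime pq /Sprime pr qr; rewrite prime_coprime // dvdn_prime2.
apply/idP/forallP => [dS q|all].
  apply/implyP => qS; apply: dvdn_trans dS.
  by rewrite (bigD1 q) //= dvdn_mulr.
have {}all q : q \in S -> (val q %| m)%N by move/implyP: (all q).
have: {in enum S, forall q, q \in S} by move=> q; rewrite mem_enum.
rewrite -big_enum /=; have := enum_uniq S.
elim: (enum S) => [|q s IHs] /=; first by rewrite big_nil dvd1n.
case/andP=> qs us sS; rewrite big_cons Gauss_dvd.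
  by rewrite all ?sS ?mem_head // IHs // => r rs; rewrite sS // inE rs orbT.
rewrite big_seq; apply: (big_ind (coprime q)) => [|u v cu cv|r rs].
- exact: coprimen1.
- by rewrite coprimeMr cu.
rewrite cop ?sS ?mem_head ?inE ?rs ?orbT //.
by apply: contraNneq qs => ->.
Qed.

(** The sum expands the product of the factors 1 - [q divides k / d] over the
    prime divisors q of k; this product is 1 if k / d = 1 and 0 otherwise. *)
Lemma moebius_primes (k d : nat) : (0 < k)%N -> (d %| k)%N ->
  \sum_(S : {set 'I_k.+1} | S \subset [set q : 'I_k.+1 | val q \in primes k])
     (-1) ^+ #|S| * (d %| k %/ \prod_(q in S) val q)%N%:R = (d == k)%:R :> rat.
Proof.
move=> k0 dk; have d0 : (0 < d)%N by apply: dvdn_gt0 dk.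
set P := [set q : 'I_k.+1 | _]; set e := (k %/ d)%N.
have ke : k = (d * e)%N by rewrite mulnC divnK.
have e0 : (0 < e)%N by rewrite divn_gt0 // dvdn_leq.
pose a (q : 'I_k.+1) : rat := if q \in P then - ((val q %| e)%N%:R) else 0.
have pP (q : 'I_k.+1) : q \in P -> prime q /\ (q %| k)%N.
  by rewrite inE mem_primes => /and3P[].
(* the factor at q outside the prime divisors of k is 1 *)
transitivity (\prod_q (a q + 1)); last first.
  have [dkE|nk] := eqVneq d k.
    rewrite big1 // => q _; rewrite /a; case: ifP => [/pP[qp _]|_]; last by rewrite add0r.
    have -> : e = 1%N by rewrite /e dkE divnn k0.
    by rewrite dvdn1; case: eqP qp => [->|]; rewrite ?oppr0 ?add0r.
  have e1 : (1 < e)%N.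
    by rewrite ltn_neqAle e0 andbT; apply: contra nk => /eqP E; rewrite ke -E muln1.
  have qk : (pdiv e < k.+1)%N.
    rewrite ltnS (leq_trans (pdiv_leq e0)) // ke leq_pmull //.
  rewrite (bigD1 (Ordinal qk)) //= /a ifT; last first.
    by rewrite inE /= mem_primes pdiv_prime // k0 ke dvdn_mull // pdiv_dvd.
  by rewrite pdiv_dvd addNr mul0r.
rewrite (bigA_distr 1 +%R) [RHS](bigID (fun S : {set 'I_k.+1} => S \subset P)) /=.
rewrite [X in _ = _ + X]big1 ?addr0; last first.
  move=> S /subsetPn[q qS qP]; rewrite (bigD1 q) //= qS /a (negPf qP) mul0r //.
apply: eq_big => // S SP.
rewrite -(big_mkcond (mem S)) /=.
have -> : \prod_(q in S) a q = \prod_(q in S) (- 1 * (val q %| e)%N%:R).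
  by apply: eq_bigr => q qS; rewrite /a (subsetP SP) // mulN1r.
rewrite big_split /= prodr_const; congr (_ * _).
have Sprime : {in S, forall q, prime (val q)}.
  by move=> q /(subsetP SP)/pP[].
have -> : (d %| k %/ \prod_(q in S) val q)%N = (\prod_(q in S) val q %| e)%N.
  have dSk : (\prod_(q in S) val q %| k)%N.
    rewrite dvd_prod_primes //; apply/forallP => q; apply/implyP => /(subsetP SP)/pP[] //.
  by rewrite dvdn_divRL // -[RHS](dvdn_pmul2l d0) -ke.
rewrite dvd_prod_primes //; case: forallP => [all|nall].
  by rewrite big1 // => q qS; have /implyP/(_ qS)-> := all q.
apply/eqP; rewrite eq_sym; apply/prodf_eq0.
have /forallP := nall; rewrite negb_forall => /existsP[q].
by rewrite negb_imply => /andP[qS nq]; exists q => //; rewrite (negPf nq).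
Qed.

(** * Elements of given degree over the prime field *)

Lemma iter_exprn (A : pzRingType) p k (x : A) :
  iter k (fun y => y ^+ p) x = x ^+ (p ^ k).
Proof. by elim: k => [|k /= ->]; rewrite ?expr1 // -exprM expnSr. Qed.

Lemma minimal_period (X : eqType) (g : X -> X) k x : (0 < k)%N ->
  iter k g x = x ->
  exists2 d, (0 < d)%N & forall m, (iter m g x == x) = (d %| m)%N.
Proof.
move=> k0 kx; pose P m := (0 < m)%N && (iter m g x == x).
have exP : exists m, P m by exists k; rewrite /P k0 kx eqxx.
case: (ex_minnP exP) => d /andP[d0 /eqP dx] dmin; exists d => // m.
apply/eqP/idP => [mx|dm]; last by rewrite (iter_modn m dx) (eqP dm).
have := dmin (gcdn d m); rewrite /P gcdn_gt0 d0 (iter_gcdn d0 dx mx) eqxx.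
move/(_ isT) => le; have -> : d = gcdn d m; last exact: dvdn_gcdr.
by apply/eqP; rewrite eqn_leq le dvdn_leq // dvdn_gcdl.
Qed.

Section PeriodicPoints.
Variables (p : nat) (p_pr : prime p) (L : closedFieldType) (charL : p \in [pchar L]).

(** The subfield of [L] with p^k elements, for k > 0. *)
Definition frobenius_fixpoints k : seq L :=
  sval (closed_field_poly_normal ('X^(p ^ k) - 'X : {poly L})).

(** The derivative of ['X^(p ^ k) - 'X] is -1, so its roots are simple. *)
Lemma frobenius_fixpointsP k : (0 < k)%N ->
  [/\ uniq (frobenius_fixpoints k), size (frobenius_fixpoints k) = (p ^ k)%N &
    forall x, (x \in frobenius_fixpoints k) = (x ^+ (p ^ k) == x)].
Proof.
move=> k0; have q1 : (1 < p ^ k)%N by rewrite -(exp1n k) ltn_exp2r // prime_gt1.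
rewrite /frobenius_fixpoints; case: closed_field_poly_normal => Z /=.
set f := 'X^(p ^ k) - 'X.
have szf : size f = (p ^ k).+1.
  by rewrite size_polyDl size_polyXn // size_polyN size_polyX ltnS.
have fmon : f \is monic.
  by rewrite monicE lead_coefDl ?lead_coefXn // size_polyXn size_polyN size_polyX ltnS.
rewrite (monicP fmon) scale1r => fZ; split.
- rewrite -separable_prod_XsubC -fZ unlock.
  have -> : f^`() = - 1%:P.
    rewrite derivB derivXn derivX -mulr_natl natrX.
    have -> : p%:R = 0 :> {poly L} by rewrite -polyC_natr (pcharf0 charL).
    by rewrite expr0n eqn0Ngt k0 mul0r sub0r.
  by rewrite -scaleN1r coprimepZr ?coprimep1 // oppr_eq0 oner_eq0.
- by have := congr1 (fun h : {poly L} => size h) fZ; rewrite szf size_prod_XsubC => -[].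
by move=> x; rewrite -root_prod_XsubC -fZ rootE /f hornerD hornerN hornerXn hornerX subr_eq0.
Qed.

Local Notation g := (fun y : L => y ^+ p).

(** The elements of [L] of degree k over F_p. *)
Definition exact_period_points k : seq L :=
  [seq x <- frobenius_fixpoints k | exact_period g k x].

Lemma mem_exact_period_points k x :
  (x \in exact_period_points k) = exact_period g k x.
Proof.
rewrite mem_filter andb_idr // => /exact_periodP[k0 kx _].
by have [_ _ ->] := frobenius_fixpointsP k0; rewrite -iter_exprn kx.
Qed.

Lemma uniq_exact_period_points k : uniq (exact_period_points k).
Proof.
have [->|k0] := posnP k; last by case: (frobenius_fixpointsP k0) => /filter_uniq->.
by rewrite /exact_period_points (eq_filter (a2 := pred0)) ?filter_pred0.
Qed.

(** Each point of the field with p^k elements has a minimal period d dividing k,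
    and lies in the field with p^m elements iff d divides m; [moebius_primes]
    then isolates d = k. *)
Lemma size_exact_period_points k : (0 < k)%N ->
  (size (exact_period_points k))%:R = k%:R * gbar p k :> rat.
Proof.
move=> k0; rewrite /gbar mulrA mulfV ?pnatr_eq0 -?lt0n // mul1r.
have [uZ szZ memZ] := frobenius_fixpointsP k0.
rewrite size_filter -sum1_count natr_sum big_mkcond /=.
transitivity (\sum_(x <- frobenius_fixpoints k)
  \sum_(S : {set 'I_k.+1} | S \subset [set q : 'I_k.+1 | val q \in primes k])
   (-1) ^+ #|S| * (iter (k %/ \prod_(q in S) val q) g x == x)%:R : rat).
  rewrite !big_seq; apply: eq_bigr => x; rewrite memZ -iter_exprn => /eqP kx.
  have [d d0 dP] := minimal_period k0 kx.
  have dk : (d %| k)%N by rewrite -dP kx.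
  under eq_bigr => S _ do rewrite dP.
  rewrite moebius_primes //; suff -> : exact_period g k x = (d == k) by case: eqP.
  apply/exact_periodP/eqP => [[_ _ minx]|<-].
    have [kd|lt] := leqP k d; first by apply/eqP; rewrite eqn_leq kd dvdn_leq.
    have d0' : d = 0%N by apply: (minx _ lt); apply/eqP; rewrite dP.
    by rewrite d0' in d0.
  split=> //; first by apply/eqP; rewrite dP.
  move=> m md /eqP; rewrite dP => dm; apply/eqP; rewrite -leqn0 leqNgt.
  by apply/negP => m0; have := dvdn_leq m0 dm; rewrite leqNgt md.
rewrite exchange_big /=; apply: eq_bigr => S SP; rewrite -mulr_sumr; congr (_ * _).
have SPq q : q \in S -> prime (val q) /\ (val q %| k)%N.
  by move/(subsetP SP); rewrite inE mem_primes => /and3P[].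
have Sk : (\prod_(q in S) val q %| k)%N.
  rewrite dvd_prod_primes => [|q /SPq[]//].
  by apply/forallP => q; apply/implyP => /SPq[].
set m := (k %/ _)%N.
have Pgt0 := dvdn_gt0 k0 Sk.
have m0 : (0 < m)%N by rewrite (divn_gt0 _ Pgt0); apply: dvdn_leq.
have mk : (m %| k)%N by apply/dvdnP; exists (\prod_(q in S) val q)%N; rewrite mulnC divnK.
have [um szm memm] := frobenius_fixpointsP m0.
rewrite -szm -natr_sum; congr _%:R.
transitivity (count (fun x => iter m g x == x) (frobenius_fixpoints k)).
  by rewrite -sum1_count [RHS]big_mkcond; apply: eq_bigr => x _; case: eqP.
rewrite -size_filter; apply/perm_size/uniq_perm => //; first exact: filter_uniq.
move=> x; rewrite mem_filter memm memZ -!iter_exprn andb_idr // => /eqP mx.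
by rewrite (iter_modn k mx) (eqP mk).
Qed.

End PeriodicPoints.

(** * Derivations at characters and monogenic algebras *)

Definition derivation_at (R L : nzRingType) (chi : R -> L)
    (D : {additive R -> L}) : Prop :=
  forall r s, D (r * s) = chi r * D s + chi s * D r.

(** The kernel of [chi] is generated by [pi] after inverting some [u] outside
    it. *)
Definition principal_kernel (R L : nzRingType) (chi : R -> L) (pi : R) : Prop :=
  chi pi = 0 /\
  exists2 u, chi u != 0 & forall z, chi z = 0 -> exists r, u * z = pi * r.

Section Derivations.
Variables (p : nat) (R : comNzRingType) (L : idomainType) (charL : p \in [pchar L]).
Variables (chi : {rmorphism R -> L}) (D : {additive R -> L}).
Hypothesis derD : derivation_at chi D.

Lemma derivation1 : D 1 = 0.
Proof.
have := derD 1 1; rewrite mulr1 rmorph1 !mul1r => /esym/eqP.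
by rewrite -subr_eq0 addrK => /eqP.
Qed.

Lemma derivation_exp r k : D (r ^+ k) = k%:R * (chi r ^+ k.-1 * D r).
Proof.
elim: k => [|k IH]; first by rewrite expr0 derivation1 mul0r.
rewrite exprS derD IH rmorphXn -natr1 mulrDl mul1r /=; congr (_ + _).
case: k {IH} => [|k]; first by rewrite !mul0r mulr0.
by rewrite /= exprS !mulrA [chi r * _]mulrC.
Qed.

Lemma derivation_pth r : D (r ^+ p) = 0.
Proof. by rewrite derivation_exp (pcharf0 charL) mul0r. Qed.

(** On the kernel of [chi], a derivation is determined by its value at [pi].
    Any [r] differs from [r ^+ (p ^ k)] by an element of the kernel, and
    derivations kill p-th powers. *)
Lemma derivation_eq0 pi k : (0 < k)%N -> (forall r, chi r ^+ (p ^ k) = chi r) ->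
  principal_kernel chi pi -> D pi = 0 -> forall r, D r = 0.
Proof.
move=> k0 chik [chi_pi [u chi_u ker]] Dpi.
have Dker z : chi z = 0 -> D z = 0.
  move=> chi_z; have [r uz] := ker z chi_z.
  have := congr1 D uz; rewrite !derD chi_z chi_pi Dpi !mul0r mulr0 !addr0.
  by move/eqP; rewrite mulf_eq0 (negPf chi_u) => /eqP.
move=> r; have /Dker : chi (r ^+ (p ^ k) - r) = 0 by rewrite rmorphB rmorphXn /= chik subrr.
rewrite raddfB /= -(prednK k0) expnSr exprM derivation_pth sub0r => /eqP.
by rewrite oppr_eq0 => /eqP.
Qed.

End Derivations.

(** Cayley-Hamilton expresses [C ^+ n] through lower powers. *)
Lemma annihilates_powers (F : fieldType) n (C : 'M[F]_n) (v : 'rV_n) (w : 'cV_n) :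
  (forall k, (k < n)%N -> v *m iter k (mulmx C) w = 0) ->
  forall k, v *m iter k (mulmx C) w = 0.
Proof.
case: n C v w => [|n] C v w vC k; first by rewrite [v]thinmx0 mul0mx.
have iterE j : iter j (mulmx C) w = C ^+ j *m w.
  by elim: j => [|j /= ->]; rewrite ?mul1mx // exprS -[C * _]/(C *m _) mulmxA.
elim/ltn_ind: k => k IH; have [/vC //|nk] := ltnP k n.+1.
pose q := char_poly C.
have qE : \poly_(i < n.+2) q`_i = q by rewrite -{1}(size_char_poly C) coefK.
have q1 : q`_n.+1 = 1.
  by have /monicP := char_poly_monic C; rewrite lead_coefE size_char_poly.
have : horner_mx C (\poly_(i < n.+2) q`_i) = 0 by rewrite qE Cayley_Hamilton.
rewrite poly_def rmorph_sum big_ord_recr /= q1 scale1r rmorphXn /= horner_mx_X.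
move/eqP; rewrite addrC addr_eq0 => /eqP Cn.
rewrite iterE -(subnK nk) exprD Cn mulrN mulNmx mulmxN mulr_sumr mulmx_suml.
rewrite mulmx_sumr big1 ?oppr0 // => i _.
rewrite linearZ rmorphXn /= horner_mx_X -scalerAr -exprD -scalemxAl -scalemxAr.
rewrite -iterE IH ?scaler0 //; apply: leq_trans (_ : _ < k - n.+1 + n.+1)%N _.
  by rewrite ltn_add2l.
by rewrite subnK.
Qed.

Section Monogenic.
Variables (p : nat) (p_pr : prime p) (R : finComNzRingType) (n : nat).
Variables (crd : {additive R -> 'rV['F_p]_n}) (b : 'I_n -> R).
Hypotheses (crd_inj : injective crd) (crdb : forall i, crd (b i) = delta_mx 0 i).
Variables (L : closedFieldType) (iota : {rmorphism 'F_p -> L}).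
Variables (T : finType) (ev : T -> {rmorphism R -> L}).
Hypotheses (ev_inj : forall s t, ev s =1 ev t -> s = t)
  (ev_surj : forall chi : {rmorphism R -> L}, exists t, ev t =1 chi).
Local Notation charL := (pchar_closure p_pr iota).
Local Notation phi := (pFrobenius_aut charL).
Variable (frob : T -> T).
Hypothesis frobE : forall t r, ev (frob t) r = ev t r ^+ p.

Let frob_inj : injective frob := frob_inj p_pr iota ev_inj frobE.

Lemma ev_iter t k r : ev (iter k frob t) r = ev t r ^+ (p ^ k).
Proof. by elim: k => [|k IH] /=; rewrite ?expr1 // frobE IH -exprM expnSr. Qed.

Lemma ev_order t r : ev t r ^+ (p ^ fingraph.order frob t) = ev t r.
Proof. by rewrite -ev_iter iter_order. Qed.

(** Characters in the same Frobenius orbit have the same kernel. *)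
Lemma ev_eq0_connect s t r : fconnect frob s t -> (ev t r == 0) = (ev s r == 0).
Proof.
move/iter_findex <-; rewrite ev_iter expf_eq0 andb_idl // => _.
by rewrite expn_gt0 prime_gt0.
Qed.

(** Galois descent.  By independence of characters, the linear system
    [ev t r = c t] has a solution [y] over [L] supported on a set of basis
    elements for which the system is invertible.  Frobenius permutes the
    equations, so it fixes the unique such solution, whose coordinates thus lie
    in F_p. *)
Lemma equivariant_values (c : T -> L) :
  (forall t, c (frob t) = c t ^+ p) -> exists r, forall t, ev t r = c t.
Proof.
move=> cfrob; pose m := #|T|.
pose E : 'M[L]_(n, m) := \matrix_(i, j) ev (enum_val j) (b i).
have Efull : row_full E.
  rewrite -[E]trmxK /row_full mxrank_tr; change (row_free E^T).
  rewrite -kermx_eq0; apply/rowV0P => v /sub_kermxP vE.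
  have v0 : forall t, v 0 (enum_rank t) = 0.
    apply: (dedekind_independence ev_inj) => r.
    under eq_bigr => t _ do rewrite (additive_crd crd_inj crdb iota) mulr_sumr.
    rewrite exchange_big big1 //= => i _.
    under eq_bigr => t _ do rewrite mulrCA.
    rewrite -mulr_sumr; have /rowP/(_ i) := vE; rewrite !mxE => vE0.
    rewrite -[RHS](mulr0 (iota (crd r 0 i))) -[in RHS]vE0; congr (_ * _).
    rewrite (reindex _ (onW_bij _ (@enum_val_bij T))) /=.
    by apply: eq_bigr => j _; rewrite enum_valK !mxE.
  by apply/rowP => j; rewrite mxE -(v0 (enum_val j)) enum_valK.
pose f := fullrankfun Efull; pose E' := rowsub f E.
have E'unit : E' \in unitmx by apply: fullrowsub_unit.
pose cv : 'rV[L]_m := \row_j c (enum_val j); pose y := cv *m invmx E'.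
have yE : y *m E' = cv by rewrite mulmxKV.
have yfix : map_mx phi y = y.
  apply: (row_free_inj (_ : row_free E')); first by rewrite row_free_unit.
  rewrite yE; apply/rowP => j.
  have [t frob_t] : exists t, frob t = enum_val j.
    by exists (finv frob (enum_val j)); rewrite f_finv.
  have := congr1 (map_mx phi) yE; rewrite map_mxM => /rowP/(_ (enum_rank t)).
  rewrite !mxE enum_rankK /= pFrobenius_autE -cfrob frob_t => <-.
  apply: eq_bigr => k _; rewrite !mxE enum_rankK -frob_t frobE.
  by rewrite /= pFrobenius_autE.
have [z zP] : exists z : 'I_m -> 'F_p, forall k, y 0 k = iota (z k).
  apply: (@fin_all_exists _ (fun=> 'F_p) (fun k z => y 0 k = iota z)) => k.
  have /matrixP/(_ 0 k) := yfix; rewrite mxE /= pFrobenius_autE.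
  exact: (frobenius_fixed p_pr).
exists (\sum_k b (f k) *+ z k) => t; rewrite raddf_sum /=.
transitivity (cv 0 (enum_rank t)); last by rewrite mxE enum_rankK.
rewrite -yE mxE; apply: eq_bigr => k _.
rewrite -/y zP !mxE enum_rankK raddfMn -mulr_natl -[in RHS](natr_Zp (z k)).
by rewrite rmorph_nat.
Qed.

Local Notation N := (fun r => map_mx iota (mulmat crd b r)).

(** The linear functional on [R] whose values on the basis are the entries of
    [v]. *)
Definition functional (v : 'rV[L]_n) r : L := (v *m map_mx iota (crd r)^T) 0 0.

Lemma functional_mul v r s : functional (v *m N r) s = functional v (s * r).
Proof. by rewrite /functional -mulmxA -map_mxM -crd_mulr. Qed.

Lemma functional_basis v i : functional v (b i) = v 0 i.
Proof.
rewrite /functional mxE (bigD1 i) //= big1 ?addr0 => [|j ji]; rewrite !mxE crdb !mxE.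
  by rewrite !eqxx rmorph1 mulr1.
by rewrite (negPf ji) andbF rmorph0 mulr0.
Qed.

Lemma functionalZ a v r : functional (a *: v) r = a * functional v r.
Proof. by rewrite /functional -scalemxAl mxE. Qed.

Lemma eigen_functional (v : 'rV[L]_n) (chi : R -> L) :
  (forall r, v *m N r = chi r *: v) -> v = functional v 1 *: \row_i chi (b i).
Proof.
move=> vN; apply/rowP => i; rewrite !mxE -functional_basis -[b i]mul1r.
by rewrite -functional_mul vN functionalZ mulrC mul1r.
Qed.

Definition power_matrix x : 'M['F_p]_n := \matrix_(i, k) crd (x ^+ k) 0 i.

Lemma power_matrix_separates x s t :
  \det (power_matrix x) != 0 -> ev s x = ev t x -> s = t.
Proof.
move=> detx st; apply: ev_inj => r; rewrite !(additive_crd crd_inj crdb iota) /=.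
pose v := \row_i (ev s (b i) - ev t (b i)).
have v0 : v *m map_mx iota (power_matrix x) = 0.
  apply/rowP => k; rewrite !mxE.
  transitivity (ev s (x ^+ k) - ev t (x ^+ k)); last by rewrite !rmorphXn /= st subrr.
  rewrite !(additive_crd crd_inj crdb iota) -sumrB; apply: eq_bigr => i _.
  by rewrite !mxE mulrC mulrBr.
have {}v0 : v = 0.
  have unitP : map_mx iota (power_matrix x) \in unitmx.
    by rewrite unitmxE det_map_mx unitfE fmorph_eq0.
  by rewrite -[v](mulmxK unitP) v0 mul0mx.
apply: eq_bigr => i _; congr (_ * _); apply/eqP; rewrite -subr_eq0.
by have /rowP/(_ i) := v0; rewrite !mxE => ->.
Qed.

(** If the determinant vanishes, some functional kills all powers of [x], and an
    eigenvector [f] of [x] among these functionals satisfies [f 1 = 0].  The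
    eigenspace [W] of [f] is stable under [R]; it contains a character [g1],
    and it is not spanned by it, as [g1 1] is nonzero.  A second vector [g2],
    eigenvector modulo [g1], has the same value at [x], hence the same character
    by separation, and the coefficient [D] of [g1] in the action of [R] on [g2]
    is a nonzero derivation that kills [x]. *)
Lemma power_matrix_nondegenerate x :
  (forall s t, ev s x = ev t x -> s = t) ->
  (forall t D, derivation_at (ev t) D -> D x = 0 -> forall r, D r = 0) ->
  \det (power_matrix x) != 0.
Proof.
move=> sep ram; apply/negP => /eqP det0.
have ND r s : N (r + s) = N r + N s by rewrite /= mulmatD map_mxD.
have NM r s : N (r * s) = N r *m N s by rewrite /= (mulmatM crd_inj crdb) map_mxM.
have N1 : N 1 = 1%:M by rewrite /= (mulmat1 crdb) map_mx1.
pose V := kermx (map_mx iota (power_matrix x)).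
have V0 : ~~ (V <= (0 : 'M[L]_n))%MS.
  rewrite submx0 kermx_eq0 row_free_unit unitmxE det_map_mx det0 rmorph0.
  by rewrite unitr0.
have VP (v : 'rV_n) : (v <= V)%MS -> forall k, functional v (x ^+ k) = 0.
  move=> vV; have vlt k : (k < n)%N -> functional v (x ^+ k) = 0.
    move=> kn; have /sub_kermxP/rowP/(_ (Ordinal kn)) := vV; rewrite [RHS]mxE => <-.
    by rewrite /functional !mxE; apply: eq_bigr => l _; rewrite !mxE.
  pose w := map_mx iota (crd 1)^T.
  have crdX k : map_mx iota (crd (x ^+ k))^T = iter k (mulmx (N x)) w.
    elim: k => [|k IH]; first by rewrite expr0.
    by rewrite exprSr (crd_mulr crd_inj crdb) map_mxM IH.
  move=> k; rewrite /functional crdX annihilates_powers ?mxE // => j jn.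
  by apply/matrixP => i l; rewrite !ord1 -crdX [LHS](vlt j jn) mxE.
have VN : (V *m N x <= V)%MS.
  apply/row_subP => i; rewrite row_mul; set v := row i V.
  have vV : (v <= V)%MS by apply: row_sub.
  apply/sub_kermxP/rowP => k; rewrite [RHS]mxE.
  rewrite -[RHS](VP v vV k.+1) exprSr -functional_mul /functional.
  by rewrite !mxE; apply: eq_bigr => l _; rewrite !mxE.
have [f /andP[fV f0] [a fa]] := eigenvector_modulo VN V0.
move: fa f0; rewrite !submx0 subr_eq0 => /eqP fa f0.
have f1 : functional f 1 = 0 by have := VP f fV 0; rewrite expr0.
pose W := kermx (N x - a%:M).
have WP (v : 'rV_n) : (v <= W)%MS = (v *m N x == a *: v).
  by rewrite -subr_eq0 -mul_mx_scalar -mulmxBr; apply/sub_kermxP/eqP.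
have WN r : (W *m N r <= W)%MS.
  apply/row_subP => i; rewrite row_mul WP -mulmxA -NM mulrC NM mulmxA.
  by have := row_sub i W; rewrite WP => /eqP->; rewrite scalemxAl.
have fW : (f <= W)%MS by rewrite WP fa.
have [r|||g1 [chi1 [g1W g10 g1N]]] := @quasi_eigen_character L n R N ND NM N1 _ _ (0 : 'M_n) W.
- by rewrite mul0mx sub0mx.
- exact: WN.
- by apply: contra f0 => W0; rewrite -submx0; apply: submx_trans W0.
rewrite submx0 in g10.
have {}g1N r : g1 *m N r = chi1 r *: g1.
  by apply/eqP; rewrite -subr_eq0 -submx0.
have g11 : functional g1 1 != 0.
  by apply: contraNneq g10 => e; rewrite (eigen_functional g1N) e scale0r.
have [r|||g2 [chi2 [g2W g20 g2N]]] := @quasi_eigen_character L n R N ND NM N1 _ _ g1 W.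
- by rewrite g1N scalemx_sub.
- exact: WN.
- apply: contra f0 => Wg1; have /sub_rVP[c Ef] := submx_trans fW Wg1.
  move/eqP: f1; rewrite Ef functionalZ mulf_eq0 (negPf g11) orbF => /eqP->.
  by rewrite scale0r.
have chi1x : chi1 x = a.
  move: g1W; rewrite WP g1N => /eqP/eqP; rewrite -subr_eq0 -scalerBl scaler_eq0.
  by rewrite (negPf g10) orbF subr_eq0 => /eqP.
have chi2x : chi2 x = a.
  have := g2N x; move: g2W; rewrite WP => /eqP->; rewrite -scalerBl => h.
  apply/eqP; rewrite eq_sym -subr_eq0; apply: contraNT g20 => nz.
  by rewrite -(eqmx_scale _ nz).
have [t1 tE1] := ev_surj chi1; have [t2 tE2] := ev_surj chi2.
have t12 : t1 = t2 by apply: sep; rewrite tE1 tE2 chi1x chi2x.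
have [D DP] : exists D : R -> L, forall r, g2 *m N r - chi2 r *: g2 = D r *: g1.
  by apply: (@fin_all_exists _ (fun=> L) (fun r d => g2 *m N r - chi2 r *: g2 = d *: g1)) => r; apply/sub_rVP.
have Duniq r d : g2 *m N r - chi2 r *: g2 = d *: g1 -> D r = d.
  rewrite DP => /eqP; rewrite -subr_eq0 -scalerBl scaler_eq0 (negPf g10) orbF.
  by rewrite subr_eq0 => /eqP.
have g2NE r : g2 *m N r = chi2 r *: g2 + D r *: g1 by rewrite -DP addrC subrK.
have DB : zmod_morphism D.
  move=> r s; apply: Duniq; have -> : N (r - s) = N r - N s.
    by apply/eqP; rewrite eq_sym subr_eq -ND subrK.
  by rewrite mulmxBr rmorphB !scalerBl -!DP !opprD !opprK addrACA.
pose DA : {additive R -> L} := HB.pack D (GRing.isZmodMorphism.Build _ _ D DB).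
have D0 : forall r, D r = 0.
  apply: (ram t2 DA) => [r s|].
    rewrite !tE2; apply: Duniq.
    rewrite NM mulmxA g2NE mulmxDl -!scalemxAl g2NE g1N -tE1 t12 tE2.
    rewrite rmorphM scalerDr !scalerA -[X in X - _]addrA -scalerDl addrAC subrr add0r.
    by rewrite [D r * _]mulrC.
  by apply: Duniq; move: g2W; rewrite WP chi2x => /eqP->; rewrite subrr scale0r.
have g2N' r : g2 *m N r = chi2 r *: g2 by rewrite g2NE D0 scale0r addr0.
case/negP: g20; apply/sub_rVP.
move: g11 (eigen_functional g1N) (eigen_functional g2N').
move: (functional g1 1) (functional g2 1) => c1 c2 c10 -> ->.
exists (c2 / c1); rewrite scalerA divfK //.
by congr (_ *: _); apply/rowP => i; rewrite !mxE -tE2 -t12 tE1.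
Qed.

(** With [ev t y = c t], the generator is [y ^+ p + w].  Taking a p-th power
    keeps the values distinct and makes [y ^+ p] invisible to derivations.  The
    sum [w] runs over orbit representatives [u]: the p-th power of [e u], the
    indicator of the orbit of [u], multiplies a local generator [pi u]. *)
Lemma monogenic_of_equivariant_injection (c : T -> L) :
  injective c -> (forall t, c (frob t) = c t ^+ p) ->
  (forall t, exists pi, principal_kernel (ev t) pi) ->
  exists x, \det (power_matrix x) != 0.
Proof.
move=> cinj cfrob prin.
have [pi piP] := @fin_all_exists _ (fun=> R) (fun t => principal_kernel (ev t)) prin.
have [y yP] := equivariant_values cfrob.
have symf := fconnect_sym frob_inj.
have bX (u : bool) : u%:R ^+ p = u%:R :> L.
  by case: u; rewrite ?expr1n //= expr0n eqn0Ngt prime_gt0.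
have [e eP] : exists e : T -> R, forall u t, ev t (e u) = (fconnect frob u t)%:R.
  apply: (@fin_all_exists _ (fun=> R)
    (fun u r => forall t, ev t r = (fconnect frob u t)%:R)) => u.
  apply: equivariant_values => t; rewrite -(same_fconnect1_r frob_inj).
  by rewrite bX.
pose w := \sum_(u | froot frob u == u) e u ^+ p * pi u.
have pi0 u t : fconnect frob u t -> ev t (pi u) = 0.
  by move=> ut; apply/eqP; rewrite (ev_eq0_connect _ ut) (piP u).1.
have w0 t : ev t w = 0.
  rewrite rmorph_sum big1 // => u _; rewrite rmorphM rmorphXn /= eP bX.
  by case: (boolP (fconnect frob u t)) => [/pi0->|_]; rewrite ?mulr0 ?mul0r.
exists (y ^+ p + w); apply: power_matrix_nondegenerate => [s t|t D derD].
  rewrite !rmorphD !rmorphXn /= !w0 !addr0 !yP -!cfrob => /cinj/frob_inj.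
  by [].
rewrite raddfD /= (derivation_pth charL derD) add0r.
pose u := froot frob t.
have ut : fconnect frob u t by rewrite symf connect_root.
have -> : D w = D (pi u).
  rewrite raddf_sum (bigD1 u) /=; last by rewrite (root_root symf).
  rewrite big1 ?addr0 => [|s /andP[/eqP sr su]].
    rewrite derD (derivation_pth charL derD) mulr0 addr0 rmorphXn /= eP bX ut.
    by rewrite mul1r.
  have nst : fconnect frob s t = false.
    by apply: contraNF su => st; rewrite -sr /u (root_connect symf).
  rewrite derD (derivation_pth charL derD) mulr0 addr0 rmorphXn /= eP bX nst.
  by rewrite mul0r.
apply: (derivation_eq0 charL derD (fingraph.order_gt0 frob t)).
  by move=> r; apply: ev_order.
have [piu [v vu ker]] := piP u; split; first exact: pi0.
exists v; first by rewrite (ev_eq0_connect _ ut).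
by move=> z /eqP; rewrite (ev_eq0_connect _ ut) => /eqP/ker.
Qed.

End Monogenic.

(** * The criterion for a finite algebra *)

(** The inequality for k compares characters and elements of [L] with Frobenius
    orbits of size k, both sides being multiplied by k. *)
Theorem monogenic_criterion (p : nat) (p_pr : prime p) (R : finComNzRingType)
    (n : nat) (crd : {additive R -> 'rV['F_p]_n}) (b : 'I_n -> R)
    (L : closedFieldType) (iota : {rmorphism 'F_p -> L})
    (h : nat) (FF : 'I_h -> {poly {mpoly 'F_p[n]}}) (delta : 'I_h -> nat) :
  injective crd -> (forall i, crd (b i) = delta_mx 0 i) ->
  (forall chi : {rmorphism R -> L}, exists pi, principal_kernel chi pi) ->
  injective FF -> (forall j, FF j \is monic) ->
  (forall j, irreducible_element (FF j)) -> (forall j, (0 < delta j)%N) ->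
  char_poly (generic_matrix (fun i => mulmat crd b (b i)))
    = \prod_j FF j ^+ delta j ->
  (exists x, \det (power_matrix crd x) != 0) <->
  (forall k, (0 < k)%N -> (#|[set j | size (FF j) == k.+1]|)%:R <= gbar p k).
Proof.
move=> crd_inj crdb prin FFinj FFmon FFirr delta0 EF.
have [T [ev [d [ev_inj ev_surj d_surj Ed]]]] := finite_characters crd_inj crdb iota.
have [frob frobE] := frobenius_permutation p_pr iota ev_surj.
have finj := frob_inj p_pr iota ev_inj frobE.
have EFL : map_poly (map_mpoly iota) (\prod_j FF j ^+ delta j)
    = \prod_j ('X - (char_form b (ev (d j)))%:P).
  by rewrite -EF -Ed map_char_poly map_generic_matrix.
have [tt [szFF ttinj ttsurj]] := irreducible_factors_orbits p_pr crd_inj crdb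
  ev_inj frobE FFinj FFmon FFirr delta0 EFL d_surj.
have charL := pchar_closure p_pr iota.
have cardT k : #|[set t | fingraph.order frob t == k]|
    = (k * #|[set j | size (FF j) == k.+1]|)%N.
  rewrite (card_order_representatives k finj ttinj ttsurj); congr (_ * #|pred_of_set _|)%N.
  by apply/setP => j; rewrite !inE szFF eqSS.
pose g (y : L) := y ^+ p.
have leD k : (0 < k)%N -> (#|[set t | fingraph.order frob t == k]|
    <= size (exact_period_points p L k))%N
    = ((#|[set j | size (FF j) == k.+1]|)%:R <= gbar p k).
  move=> k0; rewrite -(ler_nat rat) (size_exact_period_points p_pr charL k0) cardT natrM.
  by rewrite ler_pM2l // ltr0n.
split=> [[x detx] k k0|le].
  pose c t := ev t x.
  have cinj : injective c by move=> s t; apply: power_matrix_separates detx.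
  rewrite -leD // cardE -(size_map c); apply: uniq_leq_size.
    by rewrite map_inj_uniq ?enum_uniq.
  move=> _ /mapP[t + ->]; rewrite mem_enum inE => /eqP tk.
  rewrite (mem_exact_period_points p_pr charL).
  have: exact_period frob k t by rewrite (exact_period_order _ _ finj) tk.
  have cit j : iter j (fun y => y ^+ p) (c t) = c (iter j frob t).
    by elim: j => //= j ->; rewrite /c frobE.
  case/exact_periodP => _ kt mint; apply/exact_periodP; split=> //.
    by rewrite cit kt.
  by move=> m mk; rewrite cit => /cinj; apply: mint.
have [|||k|c cinj cf] := @equivariant_injection T frob L g
  (exact_period_points p L) finj.
- exact: (fmorph_inj (pFrobenius_aut charL)).
- exact: (uniq_exact_period_points p_pr charL).
- exact: (mem_exact_period_points p_pr charL).
- have [->|k0] := posnP k; last by rewrite leD ?le.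
  by rewrite cardT.
apply: (monogenic_of_equivariant_injection p_pr crd_inj crdb iota ev_inj
  ev_surj frobE cinj cf).
by move=> t; apply: prin.
Qed.

(** * Integral bases and the fundamental equation *)

(** Among the elements whose annihilator lies in the kernel of [chi], one that
    generates an ideal of minimal size is killed by this kernel. *)
Lemma socle_element (R : finComNzRingType) (F : idomainType)
    (chi : {rmorphism R -> F}) :
  exists2 a, a != 0 & forall z, chi z = 0 -> a * z = 0.
Proof.
pose P a := [forall r, (r * a == 0) ==> (chi r == 0)].
have PP a : reflect (forall r, r * a = 0 -> chi r = 0) (P a).
  by apply: (iffP forallP) => h r; [move/eqP/(implyP (h r))/eqP | apply/implyP => /eqP/h->].
pose I a := [set r * a | r : R].
have P1 : P 1 by apply/PP => r; rewrite mulr1 => ->; rewrite rmorph0.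
have [a /PP Pa amin] := arg_minnP (fun a => #|I a|) P1.
have subI s : I (s * a) \subset I a.
  by apply/subsetP => _ /imsetP[r _ ->]; rewrite mulrA; apply/imsetP; exists (r * s).
(* a multiple of a satisfying P generates the same ideal as a *)
have gen s : P (s * a) -> exists r, a = r * (s * a).
  move=> /amin le; have /eqP E : I (s * a) == I a by rewrite eqEcard subI.
  have : a \in I a by apply/imsetP; exists 1; rewrite ?mul1r.
  by rewrite -E => /imsetP[r _ Er]; exists r.
exists a => [|z chi_z].
  apply/eqP => a0; have := Pa 1; rewrite a0 mulr0 rmorph1.
  by move/(_ erefl)/eqP; rewrite oner_eq0.
have [/gen[r ra]|/PP nP] := boolP (P (z * a)).
  have /Pa : (1 - r * z) * a = 0 by rewrite mulrBl mul1r -mulrA -ra subrr.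
  by rewrite rmorphB rmorphM chi_z mulr0 subr0 rmorph1 => /eqP; rewrite oner_eq0.
have [s sza chi_s] : exists2 s, s * (z * a) = 0 & chi s != 0.
  case: (pickP (fun s => (s * (z * a) == 0) && (chi s != 0))) => [s /andP[/eqP]|none].
    by exists s.
  case: nP => r rza; apply/eqP/negPn/negP => nr.
  by have := none r; rewrite rza eqxx nr.
have [|r ra] := gen s.
  apply/PP => r; rewrite mulrA => /Pa; rewrite rmorphM => /eqP.
  by rewrite mulf_eq0 (negPf chi_s) orbF => /eqP.
by rewrite mulrC {1}ra mulrCA [z * _]mulrCA sza mulr0.
Qed.

(** The family [g] gives an eigenvector, with eigenvalue [y], of an integral
    matrix. *)
Lemma integral_of_stable_family (K : fieldType) (I : finType) (g : I -> K)
    (y : K) (C : I -> I -> int) k :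
  g k != 0 -> (forall k, y * g k = \sum_l g l *~ C k l) ->
  integralOver (intr : int -> K) y.
Proof.
move=> gk yg; pose m := #|I|.
pose A : 'M[int]_m := \matrix_(l, k) C (enum_val k) (enum_val l).
exists (char_poly A); first exact: char_poly_monic.
rewrite map_char_poly -eigenvalue_root_char.
apply/eigenvalueP; exists (\row_j g (enum_val j)).
  apply/rowP => j; rewrite !mxE yg (reindex _ (onW_bij _ (@enum_val_bij I))) /=.
  by apply: eq_bigr => l _; rewrite !mxE mulrzr.
by apply: contraNneq gk => /rowP/(_ (enum_rank k)); rewrite !mxE enum_rankK => ->.
Qed.

Section IntegralBasis.
Variables (K : fieldExtType rat) (n : nat) (deg_K : \dim {: K} = n).
Variables (xi : 'I_n -> K) (basis_xi : integral_basis xi).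

Local Notation O := (@algebraic_integer K).

Lemma intO (a : int) : O a%:~R.
Proof.
exists ('X - a%:P); first exact: monicXsubC.
by rewrite map_polyXsubC root_XsubC.
Qed.

Lemma addO x y : O x -> O y -> O (x + y). Proof. exact: integral_add. Qed.
Lemma subO x y : O x -> O y -> O (x - y). Proof. exact: integral_sub. Qed.
Lemma mulO x y : O x -> O y -> O (x * y). Proof. exact: integral_mul. Qed.

Lemma expO x k : O x -> O (x ^+ k).
Proof.
move=> Ox; elim: k => [|k IH]; first exact: (intO 1).
by rewrite exprS; apply: mulO.
Qed.

Lemma spanO (a : 'I_n -> int) : O (\sum_(i < n) xi i *~ a i).
Proof.
apply: (big_ind O); [exact: (intO 0) | exact: addO | move=> i _].
by rewrite -mulrzr; apply: mulO (intO _); apply: basis_xi.1.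
Qed.

(** Junk value 0 outside the span of [xi] over the integers. *)
Definition icoord (x : K) : {ffun 'I_n -> int} :=
  if dec_Qint_span [tuple xi i | i < n] x is left xP then sval (sig_eqW xP) else 0.

Lemma icoordK x : O x -> \sum_(i < n) xi i *~ icoord x i = x.
Proof.
move=> /basis_xi.2[a [xa _]]; rewrite /icoord; case: dec_Qint_span => [xP|[]].
  case: (sig_eqW xP) => c xc; rewrite [RHS]xc; apply: eq_bigr => i _.
  by rewrite -tnth_nth tnth_mktuple.
by exists a; rewrite xa; apply: eq_bigr => i _; rewrite -tnth_nth tnth_mktuple.
Qed.

Lemma icoord_uniq (a : 'I_n -> int) x :
  x = \sum_(i < n) xi i *~ a i -> forall i, icoord x i = a i.
Proof.
move=> xa i; have Ox : O x by rewrite xa; apply: spanO.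
have [c [_ cuniq]] := basis_xi.2 x Ox.
have <- := cuniq (icoord x) (esym (icoordK Ox)).
have -> := cuniq [ffun i => a i]; first by rewrite ffunE.
by rewrite xa; apply: eq_bigr => j _; rewrite ffunE.
Qed.

Lemma icoordB x y i : O x -> O y -> icoord (x - y) i = icoord x i - icoord y i.
Proof.
move=> Ox Oy; rewrite (icoord_uniq (a := fun i => icoord x i - icoord y i)) //.
rewrite -{1}(icoordK Ox) -{1}(icoordK Oy) -sumrB.
by apply: eq_bigr => j _; rewrite mulrzBr.
Qed.

Lemma icoord_xi i j : icoord (xi i) j = (i == j)%:R.
Proof.
rewrite (icoord_uniq (a := fun j => (i == j)%:R)) // (bigD1 i) //= eqxx.
by rewrite big1 ?addr0 // => k; rewrite eq_sym => /negPf->.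
Qed.

Lemma n_gt0 : (0 < n)%N.
Proof. by rewrite -deg_K adim_gt0. Qed.

Lemma xi_rational_basis : basis_of fullv [tuple xi i | i < n].
Proof.
rewrite basisEfree subvf size_tuple deg_K leqnn !andbT.
apply/freeP => c c0 i.
pose d : int := \prod_j denq (c j).
have d0 : d != 0 by apply/prodf_neq0 => j _; apply: denq_neq0.
have [a aP] : exists a : 'I_n -> int, forall j, (a j)%:~R = d%:~R * c j.
  apply: (@fin_all_exists _ (fun=> int) (fun j a => a%:~R = d%:~R * c j)) => j.
  exists (numq (c j) * \prod_(k | k != j) denq (c k)).
  by rewrite /d [in RHS](bigD1 j) //= !intrM numqE [RHS]mulrC mulrA.
have : \sum_(i < n) xi i *~ a i = 0.
  have /(congr1 (fun z : K => (d%:~R : rat) *: z)) := c0.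
  rewrite scaler0 => dc0; apply: etrans dc0; rewrite scaler_sumr; apply: eq_bigr => j _.
  by rewrite -tnth_nth tnth_mktuple scalerA -aP scaler_int.
move/esym/icoord_uniq => a0.
have z0 : 0 = \sum_(i < n) xi i *~ (fun=> 0) i by rewrite big1 // => j _; rewrite mulr0z.
have := aP i; rewrite -a0 (icoord_uniq z0) => /esym/eqP.
by rewrite mulf_eq0 intr_eq0 (negPf d0) => /eqP.
Qed.

Lemma embedding_scale (s : {rmorphism K -> algC}) (c : rat) x :
  s (c *: x) = ratr c * s x.
Proof.
rewrite -mulr_algl rmorphM; congr (_ * _).
exact: (fmorph_eq_rat (s \o in_alg K)).
Qed.

Variable sigma : 'I_n -> {rmorphism K -> algC}.
Hypothesis embK : embeddings sigma.

Definition conjugates : 'M[algC]_n := \matrix_(j, i) sigma j (xi i).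

Lemma conjugates_unit : conjugates \in unitmx.
Proof.
rewrite -row_free_unit -kermx_eq0; apply/rowV0P => y /sub_kermxP yV.
have y0 : forall j, y 0 j = 0.
  apply: (@dedekind_independence K algC _ sigma) => [i j ij|x].
    have [k [_ kuniq]] := embK (sigma i); apply: etrans (esym (kuniq i _)) (kuniq j _) => //.
    by move=> r; rewrite ij.
  rewrite (coord_basis xi_rational_basis (memvf x)).
  under eq_bigr => j _ do rewrite rmorph_sum mulr_sumr.
  rewrite exchange_big; apply: big1 => i _.
  under eq_bigr => j _ do rewrite embedding_scale -tnth_nth tnth_mktuple mulrCA.
  rewrite -mulr_sumr; have /rowP/(_ i) := yV; rewrite !mxE => yV0.
  rewrite -[RHS](mulr0 (ratr (coord [tuple xi i | i < n] i x))) -[in RHS]yV0.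
  by congr (_ * _); apply: eq_bigr => j _; rewrite mxE.
by apply/rowP => j; rewrite y0 mxE.
Qed.

(** The matrix of multiplication by [xi i], in the same transposed convention as
    [mulmat]. *)
Definition int_mulmat i : 'M[int]_n := \matrix_(l, k) icoord (xi k * xi i) l.

(** The matrix of the conjugates of the basis diagonalizes simultaneously all
    multiplication matrices: the j-th row is an eigenvector of multiplication by
    x with eigenvalue [sigma j x]. *)
Lemma fundamental_char_poly (F : {poly {mpoly int[n]}}) :
  fundamental_polynomial xi sigma F ->
  F = char_poly (generic_matrix int_mulmat).
Proof.
move=> FE; pose lift := map_poly (map_mpoly (n := n) (intr : int -> algC)).
have lift_inj : injective (lift : {poly {mpoly int[n]}} -> {poly {mpoly algC[n]}}).
  move=> f g fg; apply/polyP => i; apply/mpolyP => m.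
  have /(congr1 (fun q : {poly {mpoly algC[n]}} => (q`_i)@_m)) := fg.
  by rewrite !coef_map !mcoeff_map_mpoly => /intr_inj.
apply: lift_inj; rewrite [LHS]FE /lift map_char_poly map_generic_matrix.
pose Dg i : 'M[algC]_n := diag_mx (\row_j sigma j (xi i)).
have VB i : conjugates *m map_mx intr (int_mulmat i) = Dg i *m conjugates.
  apply/matrixP => j k; rewrite mul_diag_mx !mxE -rmorphM [_ * xi k]mulrC.
  have Oki : O (xi k * xi i) by apply: mulO; apply: basis_xi.1.
  rewrite -[in RHS](icoordK Oki) rmorph_sum; apply: eq_bigr => l _.
  by rewrite !mxE rmorphMz mulrzr.
pose C := @mpolyC n algC.
have detV : \det (map_mx C conjugates) != 0.
  by rewrite det_map_mx mpolyC_eq0 -unitfE -unitmxE conjugates_unit.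
rewrite (@char_poly_intertwined _ _ _ _ (generic_matrix Dg) detV).
  rewrite char_poly_trig.
    apply: eq_bigr => j _; congr ('X - _%:P); rewrite summxE.
    by apply: eq_bigr => i _; rewrite !mxE eqxx mulr1n mulrC mul_mpolyC.
  apply/is_trig_mxP => i j ij; rewrite summxE big1 // => k _.
  by rewrite !mxE (_ : (i == j) = false) ?mulr0n ?mpolyC0 ?mulr0 //; apply/eqP => E; rewrite E ltnn in ij.
rewrite mulmx_sumr mulmx_suml; apply: eq_bigr => i _.
by rewrite -scalemxAr -scalemxAl -!map_mxM VB.
Qed.

End IntegralBasis.

(** * The ring of integers modulo a prime *)

Section ResidueRing.
Variables (K : fieldExtType rat) (n : nat) (deg_K : \dim {: K} = n).
Variables (xi : 'I_n -> K) (basis_xi : integral_basis xi).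
Variables (p : nat) (p_pr : prime p).

Local Notation O := (@algebraic_integer K).
Local Notation icoord := (icoord xi).
Local Notation V := ('rV['F_p]_n).

Let red (x : K) : V := \row_i (icoord x i)%:~R.
Let lift (v : V) : K := \sum_(i < n) xi i *~ (v 0 i : nat).

Let liftO v : O (lift v). Proof. exact: spanO. Qed.

Let liftK v : red (lift v) = v.
Proof.
apply/rowP => i; rewrite mxE (icoord_uniq basis_xi (a := fun i => (v 0 i : nat)%:Z)) //.
by rewrite -pmulrn natr_Zp.
Qed.

Let redB x y : O x -> O y -> red (x - y) = red x - red y.
Proof. by move=> Ox Oy; apply/rowP => i; rewrite !mxE icoordB // rmorphB. Qed.

Let red_eq x y : O x -> O y -> red x = red y ->
  exists2 w, O w & x - y = p%:R * w.
Proof.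
move=> Ox Oy /eqP; rewrite -subr_eq0 -redB // => /eqP/rowP r0.
have [c cP] : exists c : 'I_n -> int, forall i, icoord (x - y) i = c i * p%:Z.
  apply: (@fin_all_exists _ (fun=> int) (fun i c => icoord (x - y) i = c * p%:Z)) => i.
  apply/dvdzP; rewrite (dvdz_pcharf (pchar_Fp p_pr)).
  by have := r0 i; rewrite !mxE => ->.
exists (\sum_(i < n) xi i *~ c i); first exact: spanO.
have Oxy := subO Ox Oy; rewrite -{1}(icoordK basis_xi Oxy) mulr_sumr.
by apply: eq_bigr => i _; rewrite cP -[LHS]mulrzr -[xi i *~ c i]mulrzr intrM mulrA mulrC -pmulrn.
Qed.

Let red_pM w : O w -> red (p%:R * w) = 0.
Proof.
move=> Ow; apply/rowP => i; rewrite !mxE.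
rewrite (icoord_uniq basis_xi (a := fun i => icoord w i * p%:Z)).
  by rewrite intrM -pmulrn (pcharf0 (pchar_Fp p_pr)) mulr0.
rewrite -{1}(icoordK basis_xi Ow) mulr_sumr.
by apply: eq_bigr => j _; rewrite -[RHS]mulrzr -[xi j *~ icoord w j]mulrzr intrM mulrA [LHS]mulrC -pmulrn.
Qed.

Let redM x y z : O x -> O y -> O z -> red x = red y -> red (x * z) = red (y * z).
Proof.
move=> Ox Oy Oz /(red_eq Ox Oy)[w Ow xy]; apply/eqP; rewrite -subr_eq0 -redB.
- by rewrite -mulrBl xy -mulrA red_pM //; apply: mulO.
- exact: mulO.
- exact: mulO.
Qed.

Let O1 : O 1. Proof. exact: (intO K 1). Qed.

Let red0 : red 0 = 0.
Proof. by rewrite -(mulr0 p%:R) red_pM //; apply: (intO K 0). Qed.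

(** The ring of integers modulo p, realized on coordinate vectors modulo p: the
    product of two vectors is the reduction of the product of arbitrary integral
    lifts. *)
Lemma residue_ring :
  exists (R : finComNzRingType) (crd : {additive R -> 'rV['F_p]_n}) (rho : K -> R),
  [/\ injective crd,
      forall x, crd (rho x) = \row_i (icoord x i)%:~R,
      forall x y, O x -> O y -> rho (x * y) = rho x * rho y,
      rho 1 = 1 &
      forall r, exists2 x, O x & rho x = r].
Proof.
pose mul (u v : V) : V := red (lift u * lift v).
have mulE x y : O x -> O y -> red (x * y) = mul (red x) (red y).
  move=> Ox Oy; rewrite /mul (redM (y := lift (red x))) ?liftK //.
  by rewrite mulrC [in RHS]mulrC (redM (y := lift (red y))) ?liftK.
have mulA : associative mul.
  move=> u v w; rewrite -[u]liftK -[v]liftK -[w]liftK.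
  by rewrite -!mulE ?mulrA //; apply: mulO.
have mulC : commutative mul by move=> u v; rewrite /mul mulrC.
have mul1 : left_id (red 1) mul.
  by move=> u; rewrite -[u]liftK -mulE // mul1r.
have lift_redD x y : O x -> O y -> red (x + y) = red x + red y.
  move=> Ox Oy; have O0 := intO K 0.
  rewrite -{1}[y]opprK -[- y]sub0r !redB //; last exact: subO.
  by rewrite red0 sub0r opprK.
have mulD : left_distributive mul +%R.
  move=> u v w; rewrite -[u]liftK -[v]liftK -[w]liftK.
  rewrite -lift_redD // -!mulE //; last exact: addO.
  by rewrite mulrDl lift_redD //; apply: mulO.
have nz : red 1 != 0.
  apply/eqP => r10; pose i0 := Ordinal (n_gt0 deg_K).
  have Oxi := basis_xi.1 i0.
  have /rowP/(_ i0)/eqP : red (xi i0) = 0.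
    by rewrite -[xi i0]mul1r (redM (y := 0)) ?mul0r ?red0 //; apply: (intO K 0).
  by rewrite !mxE icoord_xi // eqxx oner_eq0.
pose R : finComNzRingType := HB.pack V
  (GRing.Zmodule_isComNzRing.Build V mulA mulC mul1 mulD nz).
pose crd : {additive R -> V} := @idfun V.
exists R, crd, red; split=> //.
by move=> r; exists (lift r).
Qed.

Variables (R : finComNzRingType) (crd : {additive R -> 'rV['F_p]_n}) (rho : K -> R).
Hypotheses (crd_inj : injective crd)
  (crd_rho : forall x, crd (rho x) = \row_i (icoord x i)%:~R)
  (rhoM : forall x y, O x -> O y -> rho (x * y) = rho x * rho y)
  (rho1 : rho 1 = 1)
  (rho_surj : forall r, exists2 x, O x & rho x = r).

Lemma crd_rho_xi i : crd (rho (xi i)) = delta_mx 0 i.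
Proof.
rewrite crd_rho; apply/rowP => j; rewrite !mxE icoord_xi //= eq_sym.
by case: (j == i).
Qed.

Lemma rho_eq0 x : O x -> rho x = 0 -> exists2 w, O w & x = p%:R * w.
Proof.
move=> Ox /(congr1 crd); rewrite crd_rho raddf0 => x0.
have [w Ow xw] := red_eq Ox (intO K 0) (etrans x0 (esym red0)).
by exists w; rewrite // -xw subr0.
Qed.

Lemma rho_pM w : O w -> rho (p%:R * w) = 0.
Proof. by move=> Ow; apply: crd_inj; rewrite crd_rho raddf0; apply: red_pM. Qed.

Lemma rhoB x y : O x -> O y -> rho (x - y) = rho x - rho y.
Proof.
by move=> Ox Oy; apply: crd_inj; rewrite raddfB !crd_rho; apply: redB.
Qed.

Lemma residue_mulmat i :
  map_mx intr (int_mulmat xi i) = mulmat crd (fun i => rho (xi i)) (rho (xi i)).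
Proof.
apply/matrixP => l k; rewrite !mxE -rhoM ?crd_rho ?mxE //; exact: basis_xi.1.
Qed.

Lemma residue_power_matrix (A : 'M[int]_n) x : O x -> power_coordinates xi x A ->
  map_mx intr A = power_matrix crd (rho x).
Proof.
move=> Ox xA; apply/matrixP => i k; rewrite !mxE.
have -> : rho x ^+ k = rho (x ^+ k).
  elim: (k : nat) => [|j IH]; first by rewrite !expr0 rho1.
  by rewrite !exprS IH rhoM //; apply: expO.
by rewrite crd_rho mxE (icoord_uniq basis_xi (xA k)).
Qed.

Lemma common_inessential_divisor_residue :
  common_inessential_divisor xi p <->
  forall r : R, \det (power_matrix crd r) = 0.
Proof.
have detP (A : 'M[int]_n) x : O x -> power_coordinates xi x A ->
    (p%:Z %| \det A)%Z = (\det (power_matrix crd (rho x)) == 0).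
  move=> Ox /(residue_power_matrix Ox) <-.
  by rewrite det_map_mx (dvdz_pcharf (pchar_Fp p_pr)).
split=> [cid r|det0 x Ox].
  have [x Ox <-] := rho_surj r; have [A xA pA] := cid x Ox.
  by apply/eqP; rewrite -(detP A).
pose A : 'M[int]_n := \matrix_(i, k) icoord (x ^+ k) i.
have xA : power_coordinates xi x A.
  by move=> k; under eq_bigr do rewrite mxE; rewrite icoordK //; apply: expO.
by exists A => //; rewrite (detP _ x) ?det0.
Qed.

(** Let [a] be a nonzero element killed by the kernel of [chi], and let [y] be a
    lift of [a] divided by p.  The ideal P of integers in the kernel is spanned
    by the finite family [G], and [y] maps P into the integers.  If [y] mapped P
    into P, it would be integral and [a] would be 0.  So [y * pi] is outside P
    for some [pi] of P, and [(y * pi) * z = pi * (y * z)] for all [z] in P. *)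
Lemma residue_principal_kernel (L : fieldType) (chi : {rmorphism R -> L}) :
  exists pi, principal_kernel chi pi.
Proof.
have [a a0 aker] := socle_element chi.
have [ah Oah rah] := rho_surj a.
have pK0 : p%:R != 0 :> K by rewrite -(rmorph_nat (in_alg K)) fmorph_eq0 pnatr_eq0 -lt0n prime_gt0.
pose y := ah / p%:R.
have yO z : O z -> chi (rho z) = 0 -> O (y * z).
  move=> Oz chi_z; have [||w Ow ahz] := @rho_eq0 (ah * z).
  - exact: mulO.
  - by rewrite rhoM // rah aker.
  by rewrite /y mulrAC ahz mulrAC mulfV // mul1r.
have [g gP] : exists g : R -> K, forall r, O (g r) /\ rho (g r) = if chi r == 0 then r else 0.
  apply: (@fin_all_exists _ (fun=> K) (fun r x => O x /\ rho x = if chi r == 0 then r else 0)) => r.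
  by have [x Ox xr] := rho_surj (if chi r == 0 then r else 0); exists x.
pose G (k : R + 'I_n) := match k with inl r => g r | inr i => p%:R * xi i end.
have GO k : O (G k) /\ chi (rho (G k)) = 0.
  case: k => [r|i] /=.
    by have [Og ->] := gP r; split=> //; case: ifP => [/eqP//|_]; rewrite rmorph0.
  split; first by apply: mulO; [apply: (intO K p) | apply: basis_xi.1].
  by rewrite rho_pM ?rmorph0 //; apply: basis_xi.1.
have [|] := boolP [forall k, chi (rho (y * G k)) == 0]; last first.
  rewrite negb_forall => /existsP[k nk]; have [OG chiG] := GO k.
  exists (rho (G k)); split=> //; exists (rho (y * G k)) => // z chi_z.
  have [x Ox xz] := rho_surj z; exists (rho (y * x)).
  have Oyx : O (y * x) by apply: yO; rewrite ?xz.
  rewrite -xz -!rhoM //; last exact: yO.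
  by rewrite mulrAC [in RHS]mulrC.
move=> /forallP stable; case/negP: a0; apply/eqP.
suff Oy : O y.
  rewrite -rah; have -> : ah = p%:R * y by rewrite /y mulrC divfK.
  exact: rho_pM.
have [C CP] : exists C : R + 'I_n -> {ffun R + 'I_n -> int},
    forall k, y * G k = \sum_l G l *~ C k l.
  apply: (@fin_all_exists _ (fun=> {ffun R + 'I_n -> int})
    (fun k c => y * G k = \sum_l G l *~ c l)) => k.
  have [OG chiG] := GO k; have Ow := yO _ OG chiG; set w := y * G k in Ow *.
  have chiw : chi (rho w) == 0 by apply: stable.
  have [Og rg] := gP (rho w); rewrite chiw in rg.
  have [||v Ov wv] := @rho_eq0 (w - g (rho w)).
  - exact: subO.
  - by rewrite rhoB // rg subrr.
  exists [ffun l => match l with inl r => (r == rho w)%:R | inr i => icoord v i end].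
  rewrite big_sumType /= (bigD1 (rho w)) //= big1 => [|r /negPf nr]; last first.
    by rewrite ffunE nr mulr0z.
  rewrite ffunE eqxx addr0 -[LHS](subrK (g (rho w))) wv addrC; congr (_ + _).
  rewrite -{1}(icoordK basis_xi Ov) mulr_sumr; apply: eq_bigr => i _.
  by rewrite ffunE mulrzAr.
apply: (integral_of_stable_family (k := inr (Ordinal (n_gt0 deg_K))) _ CP).
rewrite /= mulf_neq0 //; apply/eqP => xi0.
have := icoord_xi basis_xi (Ordinal (n_gt0 deg_K)) (Ordinal (n_gt0 deg_K)).
by rewrite xi0 eqxx (icoord_uniq basis_xi (a := fun=> 0)) ?big1.
Qed.

End ResidueRing.

(** * Common inessential divisors *)

Theorem mainTheorem3
  (K : fieldExtType rat) (n : nat) (deg_K : \dim {: K} = n)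
  (xi : 'I_n -> K) (basis_xi : integral_basis xi)
  (sigma : 'I_n -> {rmorphism K -> algC}) (embK : embeddings sigma)
  (F : {poly {mpoly int[n]}}) (FE : fundamental_polynomial xi sigma F)
  (p : nat) (p_prime : prime p)
  (h : nat) (FF : 'I_h -> {poly {mpoly 'F_p[n]}}) (delta : 'I_h -> nat)
  (FF_inj : injective FF)
  (FF_monic : forall j, FF j \is monic)
  (FF_irr : forall j, irreducible_element (FF j))
  (delta_gt0 : forall j, (0 < delta j)%N)
  (F_modp : reduction p F = \prod_(j < h) FF j ^+ delta j)
  (gamma : nat) (lambda kappa : 'I_gamma -> nat)
  (kappa_inj : injective kappa)
  (lambdaE : forall i, #|[set j | size (FF j) == (kappa i).+1]| = lambda i)
  (lambda_sum : (\sum_(i < gamma) lambda i)%N = h) :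
  common_inessential_divisor xi p <->
  exists i : 'I_gamma, gbar p (kappa i) < (lambda i)%:R.
Proof.
have [R [crd [rho [crd_inj crd_rho rhoM rho1 rho_surj]]]] :=
  residue_ring deg_K basis_xi p_prime.
have [L [iota _]] := countable_algebraic_closure 'F_p.
have charF : char_poly (generic_matrix
    (fun i => mulmat crd (fun i => rho (xi i)) (rho (xi i))))
    = \prod_j FF j ^+ delta j.
  rewrite -F_modp (fundamental_char_poly deg_K basis_xi embK FE) /reduction.
  rewrite [RHS]map_char_poly.
  rewrite map_generic_matrix.
  have -> : generic_matrix (fun i => map_mx intr (int_mulmat xi i))
      = generic_matrix (fun i => mulmat crd (fun i => rho (xi i)) (rho (xi i))) :> 'M[{mpoly 'F_p[n]}]_n.
    by apply: eq_bigr => i _; rewrite (residue_mulmat basis_xi crd_rho rhoM).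
  by [].
have prin (chi : {rmorphism R -> L}) : exists pi, principal_kernel chi pi.
  exact: (residue_principal_kernel deg_K basis_xi p_prime crd_inj crd_rho rhoM
    rho_surj).
have crit := monogenic_criterion p_prime iota crd_inj
  (crd_rho_xi basis_xi crd_rho) prin FF_inj FF_monic
  FF_irr delta_gt0 charF.
apply: (iff_trans (common_inessential_divisor_residue basis_xi p_prime crd_rho
  rhoM rho1 rho_surj)).
(* the lambda i add up to h, so no degree is missing from the list kappa *)
have covered j : exists i, size (FF j) = (kappa i).+1.
  suff /existsP[i /eqP] : [exists i, size (FF j) == (kappa i).+1] by exists i.
  apply: contra_eqT lambda_sum => /existsPn none.
  rewrite neq_ltn; apply/orP; left.
  have -> : (\sum_i lambda i = \sum_j \sum_i (size (FF j) == (kappa i).+1))%N.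
    rewrite exchange_big; apply: eq_bigr => i _; rewrite -lambdaE -sum1_card.
    by rewrite big_mkcond; apply: eq_bigr => k _; rewrite inE; case: eqP.
  rewrite (bigD1 j) //= big1 ?add0n => [|i _]; last by rewrite (negPf (none i)).
  apply: leq_ltn_trans (_ : \sum_(k < h | k != j) 1 < h)%N; last first.
    by rewrite sum1_card cardC1 card_ord prednK // (leq_ltn_trans _ (ltn_ord j)).
  apply: leq_sum => k _; have [i ki|none'] := pickP (fun i => size (FF k) == (kappa i).+1).
    rewrite (bigD1 i) //= ki big1 // => i' ne; rewrite (eqP ki) eqSS.
    by rewrite (inj_eq kappa_inj) eq_sym (negPf ne).
  by rewrite big1 // => i _; rewrite none'.
have gbar_ge0 k : (0 < k)%N -> 0 <= gbar p k.
  move=> k0; rewrite -(pmulr_rge0 _ (_ : 0 < k%:R)) ?ltr0n //.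
  by rewrite -(size_exact_period_points p_prime (pchar_closure p_prime iota) k0) ler0n.
split=> [det0|[i lt] r].
  apply/existsP; apply: wlog_neg; rewrite negb_exists => /forallP le.
  case: (crit) => _ []; last by move=> x; rewrite det0 eqxx.
  move=> k k0.
  have [i /eqP ki|none] := pickP (fun i => kappa i == k).
    by rewrite -ki lambdaE leNgt le.
  rewrite (_ : [set j | _] = set0) ?cards0 ?gbar_ge0 //.
  apply/setP => j; rewrite !inE; have [i ->] := covered j.
  by rewrite eqSS none.
apply/eqP/negPn/negP => detr; have k0 : (0 < kappa i)%N.
(* a monic factor of degree 0 would be 1, a unit *)
  rewrite lt0n; apply/eqP => ki0; move: lt.
  rewrite ki0 /gbar invr0 mul0r ltr0n -lambdaE ki0 card_gt0 => /set0Pn[j].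
  rewrite inE => /eqP sz1; have [_ /negP nu _] := FF_irr j; apply: nu.
  have := monicP (FF_monic j); rewrite (size1_polyC (eq_leq sz1)) lead_coefC => ->.
  exact: unitr1.
have [/(_ (ex_intro _ r detr))/(_ _ k0)] := crit.
by rewrite lambdaE leNgt lt.
Qed.
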